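(* Let $n=p+q$ be an odd positive integer, let $V$ be an $r$-dimensional Euclidean space, let $\Omega\subset V$ be an open domain (nonempty connected open set), and let $k\ge 0$ be an integer. Let $h^a=h^a(x)$ and $g^a=g^a(x)$, $a=1,\dots,n$, be functions $\Omega\to\mathcal{C}\ell^{\mathbb{C}}(p,q)$ of class $C^k(\Omega)$ such that for all $a,b=1,\dots,n$ and all $x\in\Omega$ $$h^a(x)h^b(x)+h^b(x)h^a(x)=2\eta^{ab}e,\qquad g^a(x)g^b(x)+g^b(x)g^a(x)=2\eta^{ab}e .$$ Put $h^{1\ldots n}:=h^1(x)h^2(x)\cdots h^n(x)$ and $g^{1\ldots n}:=g^1(x)g^2(x)\cdots g^n(x)$ (these do not depend on $x$). Then for any point $x_0\in\Omega$ there exist $\varepsilon>0$ with $O_\varepsilon(x_0)\subset\Omega$ and a function $T=T(x):O_\varepsilon(x_0)\to\mathcal{C}\ell^{\mathbb{C}}(p,q)$ such that: 1. $T$ is of class $C^k(O_\varepsilon(x_0))$; 2. $T(x)$ is an invertible element of $\mathcal{C}\ell^{\mathbb{C}}(p,q)$ for every $x\in O_\varepsilon(x_0)$; 3. the following equivalences hold, where each left-hand equality is understood for all $a=1,\dots,n$ and all $x\in O_\varepsilon(x_0)$: (a) $g^a(x)=T^{-1}(x)h^a(x)T(x)\ \Leftrightarrow\ h^{1\ldots n}=g^{1\ldots n}$; (b) $g^a(x)=-T^{-1}(x)h^a(x)T(x)\ \Leftrightarrow\ h^{1\ldots n}=-g^{1\ldots n}$; (c) $g^a(x)=e^{1\ldots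 n}T^{-1}(x)h^a(x)T(x)\ \Leftrightarrow\ h^{1\ldots n}=e^{1\ldots n}g^{1\ldots n}$; (d) $g^a(x)=-e^{1\ldots n}T^{-1}(x)h^a(x)T(x)\ \Leftrightarrow\ h^{1\ldots n}=-e^{1\ldots n}g^{1\ldots n}$; (e) $g^a(x)=ie^{1\ldots n}T^{-1}(x)h^a(x)T(x)\ \Leftrightarrow\ h^{1\ldots n}=ie^{1\ldots n}g^{1\ldots n}$; (f) $g^a(x)=-ie^{1\ldots n}T^{-1}(x)h^a(x)T(x)\ \Leftrightarrow\ h^{1\ldots n}=-ie^{1\ldots n}g^{1\ldots n}$; 4. the function $T$ (with properties 1–3 on $O_\varepsilon(x_0)$) is defined up to multiplication by $\lambda(x)e+\nu(x)e^{1\ldots n}$, where $\lambda,\nu$ are complex functions of class $C^k(O_\varepsilon(x_0))$ such that $\lambda(x)e+\nu(x)e^{1\ldots n}$ is invertible at every point of $O_\varepsilon(x_0)$.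
   Context: $\mathcal{C}\ell^{\mathbb{R}}(p,q)$, $n=p+q$, is the real Clifford algebra with identity $e$ and generators $e^1,\dots,e^n$ satisfying $e^ae^b+e^be^a=2\eta^{ab}e$, where $\eta=\|\eta^{ab}\|$ is the diagonal matrix with $p$ entries $1$ followed by $q$ entries $-1$. It has dimension $2^n$, with basis $e^{a_1\ldots a_k}:=e^{a_1}\cdots e^{a_k}$, $a_1<\dots<a_k$, $0\le k\le n$ (the empty product being $e$); in particular $e^{1\ldots n}=e^1\cdots e^n$. $\mathcal{C}\ell^{\mathbb{C}}(p,q)=\mathbb{C}\otimes\mathcal{C}\ell^{\mathbb{R}}(p,q)$ is its complexification, and $i$ is the imaginary unit of $\mathbb{C}$. A function into $\mathcal{C}\ell^{\mathbb{C}}(p,q)$ is of class $C^k$ if all its complex coordinate functions with respect to this fixed basis have continuous partial derivatives up to order $k$ ($C^0$ means continuous). $O_\varepsilon(x_0)=\{x\in V:\|x-x_0\|<\varepsilon\}$. Under the stated hypotheses the products $h^{1\ldots n}$ and $g^{1\ldots n}$ do not depend on $x$, and each equals $\pm e$ (possible if $p-q\equiv 1\bmod 4$), $\pm ie$ (possible if $p-q\equiv 3\bmod 4$), or $\pm e^{1\ldots n}$ (possible in both cases); hence one of the six right-hand conditions in item 3 always holds. *)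

(* Defs.v *)
From HB Require Import structures.
From mathcomp Require Import all_boot all_order all_algebra all_field.
From mathcomp Require Import ssrAC.
From mathcomp Require Import complex.
From mathcomp Require Import all_classical all_reals all_analysis.

Set Implicit Arguments.
Unset Strict Implicit.
Unset Printing Implicit Defensive.

Import Order.TTheory GRing.Theory Num.Theory.
Import numFieldNormedType.Exports.

Local Open Scope classical_set_scope.
Local Open Scope ring_scope.

Definition eta {K : fieldType} (p q : nat) : 'M[K]_(p + q) :=
  \matrix_(a, b) (if a == b then (if (a < p)%N then 1 else -1) else 0).

(* The Clifford algebra of signature (p, q) over K, in coordinates: [X A] is
   the coefficient of [X] on [e^{a_1 ... a_k}], where A = {a_1 < ... < a_k}.
   The structure constants below lie in {1, -1}, so extending scalars from a
   field K to a field L amounts to replacing K by L: the complexification of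
   the real algebra [clifford R p q] is [clifford R[i] p q]. *)
Definition clifford (K : fieldType) (p q : nat) : Type :=
  {ffun {set 'I_(p + q)} -> K^o}.

HB.instance Definition _ (K : fieldType) (p q : nat) :=
  Vector.on (clifford K p q).

Section CliffordAlgebra.
Context {K : fieldType} {p q : nat}.
Local Notation I := 'I_(p + q).
Local Notation Cl := (clifford K p q).
Implicit Types (A B C : {set I}) (X Y Z : Cl).

Definition cl_basis A : Cl := [ffun B => (B == A)%:R].

(* Moving e^b leftwards past e^a costs a sign -1 if b < a, and
   e^a e^a = eta^{aa}. *)
Definition cl_swap (a b : I) : K :=
  if (b < a)%N then -1 else if a == b then eta p q a a else 1.

Definition cl_sign A B : K := \prod_(a in A) \prod_(b in B) cl_swap a b.

Definition symdiff A B : {set I} := (A :\: B) :|: (B :\: A).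

(* Bilinear extension of e^A e^B = cl_sign A B *: e^(symdiff A B); the
   coefficient on C collects the pairs (A, symdiff A C). *)
Definition cl_mul X Y : Cl :=
  [ffun C => \sum_A cl_sign A (symdiff A C) * (X A * Y (symdiff A C))].

Lemma in_symdiff A B x : (x \in symdiff A B) = (x \in A) (+) (x \in B).
Proof. by rewrite !inE; case: (x \in A); case: (x \in B). Qed.

Lemma symdiffAC A B C : symdiff (symdiff A B) C = symdiff B (symdiff A C).
Proof. by apply/setP=> x; rewrite !in_symdiff -addbA addbCA. Qed.

Lemma symdiffC A B : symdiff A B = symdiff B A.
Proof. by apply/setP=> x; rewrite !in_symdiff addbC. Qed.

Lemma symdiff0 A : symdiff finset.set0 A = A.
Proof. by apply/setP=> x; rewrite in_symdiff inE. Qed.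

Lemma symdiffK A : involutive (symdiff A).
Proof. by move=> B; apply/setP=> x; rewrite !in_symdiff addbA addbb. Qed.

Lemma cl_swap_sq a b : cl_swap a b * cl_swap a b = 1.
Proof.
rewrite /cl_swap mxE eqxx.
by case: ifP => _; [|case: ifP => _; [case: ifP => _|]]; rewrite ?mulrNN mulr1.
Qed.

Lemma prod_symdiff (f : I -> K) A B : (forall a, f a * f a = 1) ->
  \prod_(a in symdiff A B) f a = \prod_(a in A) f a * \prod_(a in B) f a.
Proof.
move=> f2; rewrite big_mkcond [in RHS]big_mkcond [X in _ * X]big_mkcond /=.
rewrite -big_split /=; apply: eq_bigr => a _; rewrite in_symdiff.
by case: (a \in A); case: (a \in B); rewrite /= ?mulr1 ?mul1r ?f2.
Qed.

Lemma cl_sign_symdiffr A B C :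
  cl_sign A (symdiff B C) = cl_sign A B * cl_sign A C.
Proof.
rewrite /cl_sign -big_split; apply: eq_bigr => a _ /=.
by rewrite prod_symdiff // => b; exact: cl_swap_sq.
Qed.

Lemma cl_sign_symdiffl A B C :
  cl_sign (symdiff A B) C = cl_sign A C * cl_sign B C.
Proof.
rewrite /cl_sign prod_symdiff // => a.
by rewrite -big_split big1 // => b _ /=; exact: cl_swap_sq.
Qed.

Lemma cl_sign0l A : cl_sign finset.set0 A = 1.
Proof. by rewrite /cl_sign big_set0. Qed.

Lemma cl_sign0r A : cl_sign A finset.set0 = 1.
Proof. by rewrite /cl_sign big1 // => a _; rewrite big_set0. Qed.

Lemma cl_mulA : associative cl_mul.
Proof.
move=> X Y Z; apply/ffunP => C; rewrite !ffunE.
under eq_bigr => A _ do rewrite ffunE !mulr_sumr.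
under [RHS]eq_bigr => A _ do rewrite ffunE mulr_suml mulr_sumr.
rewrite [RHS]exchange_big /=; apply: eq_bigr => A _.
rewrite [RHS](reindex_inj (inv_inj (symdiffK A))) /=.
apply: eq_bigr => B _; rewrite symdiffK [symdiff (symdiff A B) C]symdiffAC.
set D := symdiff B _.
have -> : symdiff A C = symdiff B D by rewrite /D symdiffK.
rewrite cl_sign_symdiffl cl_sign_symdiffr !mulrA.
by congr (_ * _); rewrite [LHS](ACl (2 * 4 * 1 * 3 * 5)).
Qed.

Lemma cl_mul1 : left_id (cl_basis finset.set0) cl_mul.
Proof.
move=> X; apply/ffunP => C; rewrite ffunE (bigD1 finset.set0) //= big1.
  by rewrite addr0 ffunE eqxx mul1r symdiff0 cl_sign0l mul1r.
by move=> A /negPf A0; rewrite ffunE A0 mul0r mulr0.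
Qed.

Lemma cl_mulr1 : right_id (cl_basis finset.set0) cl_mul.
Proof.
move=> X; apply/ffunP => C; rewrite ffunE (bigD1 C) //= big1.
  have -> : symdiff C C = finset.set0.
    by apply/setP=> x; rewrite in_symdiff addbb inE.
  by rewrite addr0 ffunE eqxx cl_sign0r mul1r mulr1.
move=> A AC; rewrite [cl_basis _ _]ffunE; case: eqP => [E|_]; last first.
  by rewrite !mulr0.
by case/eqP: AC; rewrite -[RHS](symdiffK A) E symdiffC symdiff0.
Qed.

Lemma cl_mulDl : left_distributive cl_mul +%R.
Proof.
move=> X Y Z; apply/ffunP => C; rewrite !ffunE -big_split /=.
by apply: eq_bigr => A _; rewrite ffunE mulrDl mulrDr.
Qed.

Lemma cl_mulDr : right_distributive cl_mul +%R.
Proof.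
move=> X Y Z; apply/ffunP => C; rewrite !ffunE -big_split /=.
by apply: eq_bigr => A _; rewrite ffunE !mulrDr.
Qed.

Lemma cl_one_neq0 : cl_basis finset.set0 != 0.
Proof.
apply/eqP => /ffunP/(_ finset.set0); rewrite !ffunE eqxx.
by move/eqP; rewrite oner_eq0.
Qed.

Lemma cl_scaleAl (c : K) X Y : c *: cl_mul X Y = cl_mul (c *: X) Y.
Proof.
apply/ffunP => C; rewrite !ffunE scaler_sumr.
by apply: eq_bigr => A _; rewrite ffunE /GRing.scale /= -mulrA mulrCA.
Qed.

Lemma cl_scaleAr (c : K) X Y : c *: cl_mul X Y = cl_mul X (c *: Y).
Proof.
apply/ffunP => C; rewrite !ffunE scaler_sumr.
by apply: eq_bigr => A _; rewrite ffunE /GRing.scale /= !(mulrCA c).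
Qed.

End CliffordAlgebra.

HB.instance Definition _ (K : fieldType) (p q : nat) :=
  GRing.Zmodule_isNzRing.Build (clifford K p q)
    cl_mulA cl_mul1 cl_mulr1 cl_mulDl cl_mulDr cl_one_neq0.
HB.instance Definition _ (K : fieldType) (p q : nat) :=
  GRing.Lmodule_isLalgebra.Build K (clifford K p q) cl_scaleAl.
HB.instance Definition _ (K : fieldType) (p q : nat) :=
  GRing.Lalgebra_isAlgebra.Build K (clifford K p q) cl_scaleAr.
HB.instance Definition _ (K : fieldType) (p q : nat) :=
  Algebra_isFalgebra.Build K (clifford K p q).

Definition cl_gen {K : fieldType} {p q : nat} (a : 'I_(p + q)) :
  clifford K p q := cl_basis (finset.set1 a).

Definition cl_vol {K : fieldType} {p q : nat} : clifford K p q :=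
  \prod_(a < p + q) cl_gen a.

Definition clifford_relations {K : fieldType} {p q : nat}
    (h : 'I_(p + q) -> clifford K p q) : Prop :=
  forall a b, h a * h b + h b * h a = (2 * eta p q a b) *: 1.

Section CliffordBasis.
Context {K : fieldType} {p q : nat}.
Local Notation I := 'I_(p + q).
Implicit Types (A B : {set I}) (X : clifford K p q).

Lemma cl_expansion X : X = \sum_A X A *: cl_basis A.
Proof.
apply/ffunP => C; rewrite sum_ffunE (bigD1 C) //= big1.
  by rewrite addr0 !ffunE eqxx /GRing.scale /= mulr1.
by move=> A /negPf CA; rewrite !ffunE eq_sym CA scaler0.
Qed.

Lemma cl_basisM A B : cl_basis A * cl_basis B =
  cl_sign A B *: cl_basis (symdiff A B) :> clifford K p q.
Proof.
apply/ffunP => C; rewrite [LHS]ffunE (bigD1 A) //= big1.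
  rewrite addr0 !ffunE eqxx mul1r /GRing.scale /=.
  have -> : (C == symdiff A B) = (symdiff A C == B).
    by rewrite (can2_eq (symdiffK A) (symdiffK A)).
  by case: eqP => [->//|_]; rewrite !mulr0.
by move=> D /negPf DA; rewrite !ffunE DA mul0r mulr0.
Qed.

Lemma cl_gen_relations : clifford_relations (@cl_gen K p q).
Proof.
move=> a b; rewrite /cl_gen !cl_basisM /cl_sign !big_set1 /cl_swap !mxE eqxx.
have [->|ab] := eqVneq a b.
  have -> : symdiff [set b]%SET [set b]%SET = finset.set0.
    by apply/setP=> x; rewrite in_symdiff addbb inE.
  by rewrite ltnn eqxx -scalerDl -mulr2n mulr_natl.
rewrite [symdiff [set b]%SET _]symdiffC -scalerDl mulr0 scale0r.
suff /eqP -> : (if (b < a)%N then -1 else 1) +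
    (if (a < b)%N then -1 else 1) == 0 :> K by rewrite scale0r.
by case: ltngtP => [_|_|/val_inj ba]; rewrite ?subrr ?addNr // ba eqxx in ab *.
Qed.

Lemma cl_basis_prod A : cl_basis A = \prod_(a in A) cl_gen a :> clifford K p q.
Proof.
have: sorted (relpre val ltn) (enum A).
  rewrite /enum_mem -enumT; apply: sorted_filter.
    by move=> ? ? ?; exact: ltn_trans.
  by rewrite -sorted_map val_enum_ord iota_ltn_sorted.
rewrite -big_filter (deprecated_filter_index_enum (mem A)).
rewrite -[A in LHS]set_enum.
elim: (enum A) => [|a s IHs] /= sorted_s.
  by rewrite big_nil; congr cl_basis; apply/setP => x; rewrite !inE.
have a_lt : {in s, forall b : I, (a < b)%N}.
  by apply/allP; apply: order_path_min sorted_s => ? ? ?; exact: ltn_trans.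
rewrite big_cons -IHs ?(path_sorted sorted_s) // cl_basisM.
rewrite /cl_sign big_set1 big1 ?scale1r.
  congr cl_basis; apply/setP => x; rewrite in_symdiff !inE.
  by case: eqVneq => //= ->; case: (boolP (a \in s)) => // /a_lt; rewrite ltnn.
move=> b; rewrite inE => /a_lt ab; rewrite /cl_swap ltnNge ltnW //=.
by case: eqP ab => // ->; rewrite ltnn.
Qed.

End CliffordBasis.

(* The Euclidean norm on R^r; the library's norm on ['rV_r] is the sup norm,
   which induces the same topology. *)
Definition enorm {R : realType} {r : nat} (x : 'rV[R]_r) : R :=
  Num.sqrt (\sum_i x 0 i ^+ 2).

Definition eball {R : realType} {r : nat} (x0 : 'rV[R]_r) (eps : R) :
  set 'rV[R]_r := [set x | enorm (x - x0) < eps].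

(* Functions on an open set U are represented by total functions whose values
   outside U are irrelevant. *)
Fixpoint classC {R : realType} {r : nat} (k : nat) (U : set 'rV[R]_r)
    (f : 'rV[R]_r -> R) : Prop :=
  (forall x, U x -> {for x, continuous f}) /\
  if k is k'.+1 then
    forall i : 'I_r, (forall x, U x -> derivable f x (delta_mx 0 i)) /\
      classC k' U (fun x => 'D_(delta_mx 0 i) f x)
  else True.

Definition classC_complex {R : realType} {r : nat} (k : nat)
    (U : set 'rV[R]_r) (f : 'rV[R]_r -> R[i]) : Prop :=
  classC k U (fun x => complex.Re (f x)) /\
  classC k U (fun x => complex.Im (f x)).

Definition classC_clifford {R : realType} {p q r : nat} (k : nat)
    (U : set 'rV[R]_r) (F : 'rV[R]_r -> clifford R[i] p q) : Prop :=
  forall A : {set 'I_(p + q)}, classC_complex k U (fun x => F x A).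

(* [H] and [G] are the constant values of h^{1...n} and g^{1...n}. *)
Definition pauli_transform {R : realType} {p q r : nat} (k : nat)
    (U : set 'rV[R]_r) (h g : 'I_(p + q) -> 'rV[R]_r -> clifford R[i] p q)
    (H G : clifford R[i] p q) (T : 'rV[R]_r -> clifford R[i] p q) : Prop :=
  let w : clifford R[i] p q := cl_vol in
  classC_clifford k U T /\
  (forall x, U x -> T x \is a GRing.unit) /\
  ((forall a x, U x -> g a x = (T x)^-1 * h a x * T x) <-> H = G) /\
  ((forall a x, U x -> g a x = - ((T x)^-1 * h a x * T x)) <-> H = - G) /\
  ((forall a x, U x -> g a x = w * (T x)^-1 * h a x * T x) <->
     H = w * G) /\
  ((forall a x, U x -> g a x = - (w * (T x)^-1 * h a x * T x)) <->
     H = - (w * G)) /\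
  ((forall a x, U x -> g a x = 'i%C *: w * (T x)^-1 * h a x * T x) <->
     H = 'i%C *: w * G) /\
  ((forall a x, U x -> g a x = - ('i%C *: w * (T x)^-1 * h a x * T x)) <->
     H = - ('i%C *: w * G)).

(* Main.v *)
(* A family satisfying the Clifford relations induces a map e^A |-> h^A. With
   sigma_A = e^A e^A, the average T = sum_A sigma_A h^A F g^A satisfies
   h^a T = T g^a for every F. Taking g^a = +- e^a and summing over
   F = e^B shows that on each of the two central ideals of the algebra some
   average is nonzero; combining one from each ideal yields an invertible T
   with h^a = T s e^a T^{-1}, where s is a central square root of 1. Hence
   h^{1...n} = s e^{1...n} takes finitely many values and is constant on a
   connected domain. Two families are then intertwined, up to a central sign,
   by an invertible T_0 at the point x_0, and the average with F = T_0 is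
   2^n T_0 at x_0, hence invertible nearby, and it is polynomial in h and g,
   hence of class C^k. Uniqueness holds because the quotient of two
   intertwiners commutes with all g^a, so it is central. *)
Require Import Defs.
From mathcomp Require Import all_boot all_order all_algebra all_field.
From mathcomp Require Import complex ring.
From mathcomp Require Import all_classical all_reals all_analysis.
Import Order.TTheory GRing.Theory Num.Theory.
Import numFieldNormedType.Exports.
Local Open Scope classical_set_scope.
Local Open Scope ring_scope.

Set Implicit Arguments.
Unset Strict Implicit.
Unset Printing Implicit Defensive.

(** * Averages of Clifford families *)

Section CliffordFamilies.
Context {K : fieldType} {p q : nat}.
Hypothesis two_neq0 : 2 != 0 :> K.
Local Notation I := 'I_(p + q).
Local Notation Cl := (clifford K p q).
Local Notation sgn := (@cl_sign K p q).
Implicit Types (A B : {set I}) (X Y Z F : Cl) (h g : I -> Cl).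

Definition monomial h A : Cl := \prod_(a in A) h a.

Lemma monomial_basis A : monomial cl_gen A = cl_basis A.
Proof. by rewrite cl_basis_prod. Qed.

Lemma monomial_enum h A : monomial h A = \prod_(a <- enum A) h a.
Proof.
by rewrite /monomial -big_filter (deprecated_filter_index_enum (mem A)).
Qed.

Lemma monomial0 h : monomial h finset.set0 = 1.
Proof. by rewrite /monomial big_set0. Qed.

Lemma monomial1 h a : monomial h (finset.set1 a) = h a.
Proof. by rewrite /monomial big_set1. Qed.

Lemma monomial_cons h (a : I) A : {in A, forall b : I, (a < b)%N} ->
  h a * monomial h A = monomial h (a |: A)%SET.
Proof.
move=> aA; rewrite !monomial_enum.
have srt (B : {set I}) : sorted (relpre val ltn) (enum B).
  rewrite /enum_mem -enumT; apply: sorted_filter.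
    by move=> ? ? ?; exact: ltn_trans.
  by rewrite -sorted_map val_enum_ord iota_ltn_sorted.
have -> : enum (a |: A)%SET = a :: enum A.
  apply: (@irr_sorted_eq _ (relpre val ltn)) => //.
  - by move=> ? ? ?; exact: ltn_trans.
  - by move=> ?; rewrite /= ltnn.
  - rewrite /= path_min_sorted //.
    by apply/allP => b; rewrite mem_enum => /aA.
  - by move=> b; rewrite in_cons !mem_enum !inE.
by rewrite big_cons.
Qed.

Lemma min_elem A : A != finset.set0 -> exists2 a : I,
  a \in A & {in (A :\ a)%SET, forall b : I, (a < b)%N}.
Proof.
case/set0Pn => a0 Aa0; case: (arg_minnP (fun b : I => b : nat) Aa0) => a Aa amin.
exists a => // b; rewrite !inE => /andP[ba Ab].
by rewrite ltn_neqAle amin // andbT eq_sym.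
Qed.

Lemma cl_sign_lt (a : I) A : {in A, forall b : I, (a < b)%N} ->
  sgn (finset.set1 a) A = 1.
Proof.
move=> aA; rewrite /cl_sign big_set1 big1 // => b /aA ab.
by rewrite /cl_swap ltnNge ltnW //= -val_eqE ltn_eqF.
Qed.

Lemma symdiff_set1 a A : a \notin A -> symdiff (finset.set1 a) A = (a |: A)%SET.
Proof.
move=> aA; apply/setP=> x; rewrite in_symdiff !inE.
by case: eqVneq => //= ->; rewrite (negPf aA).
Qed.

Lemma symdiff_set1D a A : a \in A -> symdiff (finset.set1 a) A = (A :\ a)%SET.
Proof.
move=> aA; apply/setP=> x; rewrite in_symdiff !inE.
by case: eqVneq => //= ->; rewrite aA.
Qed.

Lemma cl_sign_sq A B : sgn A B * sgn A B = 1.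
Proof.
have symdiffv : symdiff A A = finset.set0.
  by apply/setP=> x; rewrite in_symdiff addbb inE.
by rewrite -cl_sign_symdiffl symdiffv cl_sign0l.
Qed.

Lemma clifford_sq h a : clifford_relations h -> h a * h a = eta p q a a *: 1.
Proof.
move=> /(_ a a); rewrite -mulr2n -scaler_nat -scalerA.
exact: (scalerI two_neq0).
Qed.

Lemma clifford_anticomm h a b : clifford_relations h -> a != b ->
  h a * h b = - (h b * h a).
Proof.
move=> /(_ a b) + ab; rewrite !mxE (negPf ab) mulr0 scale0r => /eqP.
by rewrite addr_eq0 => /eqP.
Qed.

(** Induction on the size of [A] through its least element [m]. If [a < m] the factor is already in
    place; if [a > m] it passes [h m] at the cost of a sign and the induction goes on below; if
    [a = m] the square contributes [eta]. *)
Lemma monomial_gen h a A : clifford_relations h ->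
  h a * monomial h A =
  sgn (finset.set1 a) A *: monomial h (symdiff (finset.set1 a) A).
Proof.
move=> hrel; have [n] := ubnP #|A|; elim: n A a => // n IH A a cardA.
have [->|/min_elem [m Am mA]] := eqVneq A finset.set0.
  by rewrite symdiffC symdiff0 monomial1 monomial0 mulr1 cl_sign0r scale1r.
have ltA : (#|(A :\ m)%SET| < n)%N.
  by move: cardA; rewrite (finset.cardsD1 m A) Am.
have nAm : m \notin (A :\ m)%SET by rewrite !inE eqxx.
have mon : monomial h A = h m * monomial h (A :\ m)%SET.
  by rewrite monomial_cons // finset.setD1K.
have sm : sgn (finset.set1 a) A = cl_swap a m * sgn (finset.set1 a) (A :\ m)%SET.
  rewrite -{1}(finset.setD1K Am) -(symdiff_set1 nAm) cl_sign_symdiffr.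
  by rewrite {1}/cl_sign !big_set1.
have [am|ma|/val_inj am] := ltngtP a m.
- have aA : {in A, forall b : I, (a < b)%N}.
    move=> b Ab; have [->//|bm] := eqVneq b m.
    by apply: ltn_trans am _; apply: mA; rewrite !inE bm.
  rewrite monomial_cons // cl_sign_lt // scale1r symdiff_set1 //.
  by apply/negP => /aA; rewrite ltnn.
- have nam : a != m by rewrite -val_eqE gtn_eqF.
  rewrite mon mulrA clifford_anticomm // mulNr -mulrA IH //.
  rewrite -scalerAr monomial_cons; last first.
    move=> b; rewrite in_symdiff [b \in finset.set1 a]inE.
    by case: eqVneq => [->//|_] /= /mA.
  rewrite sm /cl_swap ma mulN1r scaleNr; congr (- (_ *: monomial h _)).
  apply/setP => x; rewrite !(in_symdiff, inE).
  case: eqVneq => //= ->; rewrite eq_sym (negPf nam) Am //.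
subst a; rewrite mon mulrA clifford_sq // -scalerAl mul1r sm cl_sign_lt // mulr1.
by rewrite /cl_swap ltnn eqxx symdiff_set1D.
Qed.

(** Peels off the least element of [A] and recombines signs by the multiplicativity of [cl_sign] in
    each argument. The structure constants are those of the basis, so e^A |-> h^A is
    multiplicative. *)
Lemma monomialM h A B : clifford_relations h ->
  monomial h A * monomial h B = sgn A B *: monomial h (symdiff A B).
Proof.
move=> hrel; have [n] := ubnP #|A|; elim: n A B => // n IH A B cardA.
have [->|/min_elem [m Am mA]] := eqVneq A finset.set0.
  by rewrite symdiff0 monomial0 mul1r cl_sign0l scale1r.
have ltA : (#|(A :\ m)%SET| < n)%N.
  by move: cardA; rewrite (finset.cardsD1 m A) Am.
have nAm : m \notin (A :\ m)%SET by rewrite !inE eqxx.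
have EA : A = symdiff (finset.set1 m) (A :\ m)%SET.
  by rewrite symdiff_set1 ?finset.setD1K.
rewrite -{1}(finset.setD1K Am) -monomial_cons // -mulrA.
rewrite IH // -scalerAr monomial_gen // scalerA.
rewrite cl_sign_symdiffr cl_sign_lt // mul1r mulrC -cl_sign_symdiffl -EA.
congr (_ *: monomial h _).
by apply/setP => x; rewrite {2}EA !in_symdiff addbA.
Qed.

(** For a Clifford family [g] the square of g^A is the sign [sgn A A], so each summand is h^A F
    (g^A)^-1. This is the Reynolds operator of the finite group of signed monomials. *)
Definition cl_average h g F : Cl :=
  \sum_A sgn A A *: (monomial h A * F * monomial g A).

(** Toggling [a] in the index set permutes the summands: h^a absorbed on the left of one term
    matches g^a absorbed on the right of its partner. *)
Lemma cl_averageP h g F a : clifford_relations h -> clifford_relations g ->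
  h a * cl_average h g F = cl_average h g F * g a.
Proof.
move=> hrel grel; rewrite mulr_sumr mulr_suml.
rewrite (reindex_inj (inv_inj (symdiffK (finset.set1 a)))) /=.
apply: eq_bigr => A _; rewrite -scalerAr -scalerAl.
have -> : monomial h A * F * monomial g A * g a =
    sgn A (finset.set1 a) *:
      (monomial h A * F * monomial g (symdiff (finset.set1 a) A)).
  by rewrite -mulrA -(monomial1 g a) monomialM // symdiffC scalerAr.
rewrite 2!mulrA monomial_gen // symdiffK -2!scalerAl !scalerA.
congr (_ *: _); rewrite cl_sign_symdiffl -mulrA mulrC -mulrA cl_sign_sq mulr1.
by rewrite cl_sign_symdiffr mulrC.
Qed.

End CliffordFamilies.

(** * The center in odd dimension and the projection onto it *)

Section CliffordCenter.
Context {K : fieldType} {p q : nat}.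
Hypothesis two_neq0 : 2 != 0 :> K.
Hypothesis odd_n : odd (p + q).
Local Notation I := 'I_(p + q).
Local Notation Cl := (clifford K p q).
Local Notation sgn := (@cl_sign K p q).
Local Notation w := (@cl_vol K p q).
Local Notation full := (finset.setT : {set I}).
Implicit Types (A B : {set I}) (X Y Z F : Cl) (h g : I -> Cl) (a b : I).

Lemma cl_volE : w = cl_basis full.
Proof. by rewrite cl_basis_prod; apply: eq_bigl => a; rewrite inE. Qed.

(* [X A] has type [K^o]; without the casts scalar multiplication is inferred
   over the field [K^o]. *)
Lemma cl_basis_sum X : X = \sum_A (X A : K) *: (cl_basis A : Cl).
Proof. exact: cl_expansion. Qed.

Lemma cl_basisMl A B X : (cl_basis A * X) (symdiff A B) = sgn A B * X B.
Proof.
rewrite [LHS]ffunE (bigD1 A) //= big1 ?addr0.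
  by rewrite ffunE eqxx mul1r symdiffK.
by move=> D /negPf DA; rewrite ffunE DA mul0r mulr0.
Qed.

Lemma cl_basisMr A B X : (X * cl_basis A) (symdiff B A) = sgn B A * X B.
Proof.
rewrite [LHS]ffunE (bigD1 B) //= big1 ?addr0.
  by rewrite ffunE symdiffK eqxx mulr1.
move=> D DB; rewrite ffunE; case: eqP => [E|_]; last by rewrite !mulr0.
case/eqP: DB; apply/setP => x; move/setP/(_ x): E; rewrite !in_symdiff.
by case: (x \in D); case: (x \in A); case: (x \in B).
Qed.

(** This is the group commutator of e^a and e^A: every b in A other than a contributes -1, while b =
    a contributes [eta] squared, that is 1. *)
Lemma cl_sign_comm a A : sgn (finset.set1 a) A * sgn A (finset.set1 a) =
  (-1) ^+ #|(A :\ a)%SET|.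
Proof.
rewrite /cl_sign big_set1.
under [X in _ * X]eq_bigr => b _ do rewrite big_set1.
rewrite -big_split /= (eq_bigr (fun b => if b != a then -1 else 1)); last first.
  move=> b _; rewrite /cl_swap; case: (eqVneq b a) => [->|ba].
    by rewrite ltnn /= mxE eqxx; case: ifP => _; rewrite ?mulrNN mulr1.
  by move: ba; rewrite -!val_eqE; case: ltngtP => //= _ _; rewrite ?mulr1 ?mul1r.
rewrite -big_mkcondr /= -prodr_const; apply: eq_bigl => b.
by rewrite !inE andbC.
Qed.

(** By [cl_sign_comm], an index outside [A] works when the size of [A] is odd, and an index inside
    [A] works when it is even. *)
Lemma cl_basis_anticomm A : A != finset.set0 -> A != full ->
  exists a, sgn (finset.set1 a) A * sgn A (finset.set1 a) = -1.
Proof.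
move=> A0 AT; case oddA: (odd #|A|).
  have: (~: A)%SET != finset.set0.
    by rewrite -finset.setCT (inj_eq (@finset.setC_inj I)).
  case/set0Pn => a; rewrite inE => aA; exists a; rewrite cl_sign_comm.
  by move: oddA; rewrite (finset.cardsD1 a A) (negPf aA) add0n -signr_odd => ->.
case/set0Pn: A0 => a aA; exists a; rewrite cl_sign_comm -signr_odd.
by move/negbT: oddA; rewrite (finset.cardsD1 a A) aA add1n oddS negbK => ->.
Qed.

(** Comparing coefficients of both sides shows that [Z A] equals its negative as soon as some
    generator anticommutes with e^A, which leaves only the empty and the full index set. *)
Lemma cl_commutantP Z : (forall a, cl_gen a * Z = Z * cl_gen a) ->
  Z = (Z finset.set0 : K) *: 1 + (Z full : K) *: w.
Proof.
move=> comZ.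
have Z0 A : A != finset.set0 -> A != full -> Z A = 0.
  move=> A0 AT; have [a sa] := cl_basis_anticomm A0 AT.
  have := congr1 (fun X : Cl => X (symdiff (finset.set1 a) A)) (comZ a).
  rewrite /= cl_basisMl symdiffC cl_basisMr.
  move/(congr1 ( *%R (sgn (finset.set1 a) A))).
  rewrite !mulrA cl_sign_sq sa mul1r mulN1r => /eqP.
  by rewrite -addr_eq0 -mulr2n -mulr_natl mulf_eq0 (negPf two_neq0) => /eqP.
rewrite {1}[Z]cl_basis_sum (bigD1 finset.set0) //= (bigD1 full) /=.
  rewrite big1 ?addr0 ?cl_volE // => A /andP[A0 AT].
  by rewrite Z0 // scale0r.
by apply/set0Pn; have := odd_gt0 odd_n => n0; exists (Ordinal n0); rewrite inE.
Qed.

Lemma cl_central Z : (forall a, cl_gen a * Z = Z * cl_gen a) ->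
  forall X, Z * X = X * Z.
Proof.
move=> comZ X; rewrite [X]cl_basis_sum mulr_sumr mulr_suml.
apply: eq_bigr => A _; rewrite -scalerAr -scalerAl; congr (_ *: _).
rewrite cl_basis_prod; apply: (@commr_prod Cl) => a _; exact/esym/comZ.
Qed.

(** A generator meets n - 1 others in the full product, and this number is even for odd n. *)
Lemma cl_vol_central X : w * X = X * w.
Proof.
apply: cl_central => a; rewrite cl_volE cl_basisM cl_basisM symdiffC.
congr (_ *: _); have := cl_sign_comm a full.
rewrite -signr_odd.
have -> : odd #|(full :\ a)%SET| = false.
  have := finset.cardsD1 a full; rewrite finset.cardsT card_ord inE.
  by move/(congr1 odd); rewrite odd_n add1n oddS; case: odd.
move/(congr1 ( *%R^~ (sgn full (finset.set1 a)))).
by rewrite -mulrA cl_sign_sq mulr1 mul1r.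
Qed.

Lemma cl_central_scale (l m : K) X : (l *: 1 + m *: w) * X = X * (l *: 1 + m *: w).
Proof.
by rewrite mulrDl mulrDr -!scalerAl -!scalerAr mul1r mulr1 cl_vol_central.
Qed.

Lemma cl_average_basis A : cl_average cl_gen cl_gen (cl_basis A) =
  (\sum_B sgn B A * sgn A B) *: cl_basis A.
Proof.
rewrite scaler_suml; apply: eq_bigr => B _; rewrite monomial_basis.
rewrite !cl_basisM -scalerAl cl_basisM !scalerA cl_sign_symdiffl.
rewrite [symdiff (symdiff _ _) _]symdiffC symdiffK.
congr (_ *: _); transitivity (sgn B B * sgn B B * (sgn B A * sgn A B)).
  by ring.
by rewrite cl_sign_sq mul1r.
Qed.

Lemma cl_average_coef X C : cl_average cl_gen cl_gen X C =
  (\sum_B sgn B C * sgn C B) * X C.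
Proof.
have -> : cl_average cl_gen cl_gen X =
    \sum_A (X A : K) *: cl_average cl_gen cl_gen (cl_basis A).
  rewrite {1}[X]cl_basis_sum /cl_average.
  under eq_bigr => B _ do rewrite mulr_sumr mulr_suml scaler_sumr.
  rewrite exchange_big /=; apply: eq_bigr => A _.
  rewrite scaler_sumr; apply: eq_bigr => B _.
  by rewrite -scalerAr -scalerAl !scalerA mulrC.
rewrite sum_ffunE (bigD1 C) //= big1 ?addr0.
  by rewrite cl_average_basis !ffunE eqxx /GRing.scale /= mulr1 mulrC.
move=> A /negPf CA; rewrite cl_average_basis !ffunE eq_sym CA.
by rewrite !scaler0.
Qed.

(** The average is 2^n times the coordinate projection onto the center. It lies in the commutant of
    the generators, and the two remaining coefficients are sums of 2^n terms equal to 1, because 1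
    and [w] commute with every e^B. *)
Lemma cl_averageE X : cl_average cl_gen cl_gen X =
  2 ^+ (p + q) *: ((X finset.set0 : K) *: 1 + (X full : K) *: w).
Proof.
have cardI : #|{set I}| = (2 ^ (p + q))%N.
  by rewrite -finset.cardsT -powersetT card_powerset finset.cardsT card_ord.
have rel := @cl_gen_relations K p q.
rewrite [LHS]cl_commutantP => [|a]; last exact: cl_averageP.
rewrite scalerDr !scalerA !cl_average_coef; congr (_ * _ *: _ + _ * _ *: _).
  rewrite -natrX -cardI -sum1_card natr_sum; apply: eq_bigr => B _.
  by rewrite cl_sign0l cl_sign0r mulr1.
rewrite -natrX -cardI -sum1_card natr_sum; apply: eq_bigr => B _.
have := cl_vol_central (cl_basis B).
rewrite cl_volE !cl_basisM symdiffC => /ffunP/(_ (symdiff B full)).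
by rewrite !ffunE eqxx /GRing.scale /= !mulr1 => ->; exact: cl_sign_sq.
Qed.
End CliffordCenter.

(** * Normal form of a Clifford family *)

Section ProductLemmas.
Context {A : pzRingType} {I : finType}.
Implicit Types (T c : A) (h k : I -> A).

Lemma prod_intertwine (r : seq I) T h k : (forall a, h a * T = T * k a) ->
  \prod_(a <- r) h a * T = T * \prod_(a <- r) k a.
Proof.
move=> hT; elim: r => [|a r IH]; first by rewrite !big_nil mul1r mulr1.
by rewrite !big_cons -mulrA IH mulrA hT mulrA.
Qed.

Lemma prod_centralM c k : (forall X, c * X = X * c) ->
  \prod_a (c * k a) = c ^+ #|I| * \prod_a k a.
Proof.
move=> cc; have -> : #|I| = size (index_enum I).
  by rewrite [index_enum I]unlock -enumT cardE.
elim: (index_enum I) => [|a r IH]; first by rewrite !big_nil mulr1.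
rewrite !big_cons IH /= exprS -!mulrA; congr (c * _); rewrite !mulrA.
by congr (_ * _); apply: commrX; exact/esym/cc.
Qed.

Lemma expr_odd_involution c n : c * c = 1 -> odd n -> c ^+ n = c.
Proof.
move=> c2 odn; rewrite -(odd_double_half n) odn add1n exprS -mul2n exprM.
by rewrite expr2 c2 expr1n mulr1.
Qed.
End ProductLemmas.

(** In finite dimension an injective left multiplication is onto, which gives a right inverse [Y];
    injectivity applied to T (Y T - 1) = 0 makes it two-sided. *)
Lemma falg_unit_inj (K : fieldType) (A : falgType K) (T : A) :
  (forall X, T * X = 0 -> X = 0) -> T \is a GRing.unit.
Proof.
move=> injT.
have ker0 : lker (amull T) == 0%VS.
  apply/lker0P => X Y; rewrite !lfunE /= => /eqP; rewrite -subr_eq0 -mulrBr.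
  by move/eqP/injT/eqP; rewrite subr_eq0 => /eqP.
have TY : T * (amull T)^-1%VF 1 = 1.
  by have := lker0_lfunVK ker0 1; rewrite !lfunE.
apply/unitrP; exists ((amull T)^-1%VF 1); split => //.
apply/eqP; rewrite -subr_eq0; apply/eqP/injT.
by rewrite mulrBr mulrA TY mul1r mulr1 subrr.
Qed.

Section PauliPointwise.
Context {K : fieldType} {p q : nat}.
Hypothesis two_neq0 : 2 != 0 :> K.
Hypothesis odd_n : odd (p + q).
Local Notation I := 'I_(p + q).
Local Notation Cl := (clifford K p q).
Local Notation sgn := (@cl_sign K p q).
Local Notation w := (@cl_vol K p q).
Local Notation full := (finset.setT : {set I}).
Implicit Types (A B : {set I}) (X Y Z F T : Cl) (h g : I -> Cl) (a b : I).

(** Rescales the volume element to a central involution [u]. Over the complex numbers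
    [vol_involution] provides [kappa] as 1 or i, according to the sign of the square of [w]. *)
Variable kappa : K.
Local Notation u := (kappa *: w).
Hypothesis u_sq : u * u = 1.

Lemma monomial_scale (s : K) A :
  monomial (fun a => s *: cl_gen a) A = s ^+ #|A| *: cl_basis A :> Cl.
Proof.
rewrite -monomial_basis !monomial_enum cardE.
elim: (enum A) => [|a r IH]; first by rewrite !big_nil scale1r.
by rewrite !big_cons IH -scalerAl -scalerAr scalerA -exprS.
Qed.

Lemma scale_gen_relations (s : K) : s * s = 1 ->
  clifford_relations (fun a => s *: cl_gen a : Cl).
Proof.
move=> s2 a b; rewrite -!scalerAl -!scalerAr !scalerA s2 !scale1r.
exact: cl_gen_relations.
Qed.

Lemma full_neq0 : full != finset.set0.
Proof.
by apply/set0Pn; have := odd_gt0 odd_n => n0; exists (Ordinal n0); rewrite inE.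
Qed.

(** After exchanging the sums, the sum over [B] averages g^A over the standard generators. This
    keeps only central components, so only the empty and the full [A] survive. *)
Lemma sum_cl_average h (s : K) : s * s = 1 ->
  \sum_B sgn B B *: (cl_average h (fun a => s *: cl_gen a) (cl_basis B) *
    cl_basis B) =
  2 ^+ (p + q) *: (1 + (sgn full full * s) *: (monomial h full * w)).
Proof.
move=> s2; rewrite /cl_average.
transitivity (\sum_A sgn A A *: (monomial h A *
    cl_average cl_gen cl_gen (s ^+ #|A| *: cl_basis A : Cl))).
  under eq_bigr => B _ do rewrite mulr_suml scaler_sumr.
  rewrite exchange_big /=; apply: eq_bigr => A _.
  rewrite mulr_sumr scaler_sumr; apply: eq_bigr => B _.
  rewrite monomial_scale monomial_basis -!(scalerAl, scalerAr) !scalerA !mulrA.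
  by congr (_ *: _); ring.
have coef A C : (s ^+ #|A| *: cl_basis A : Cl) C =
    s ^+ #|A| * (C == A)%:R :> K by rewrite !ffunE.
under eq_bigr => A _ do rewrite cl_averageE // !coef.
rewrite (bigD1 finset.set0) //= (bigD1 full) ?full_neq0 //= big1; last first.
  move=> A /andP[/negPf A0 /negPf AT].
  by rewrite eq_sym A0 eq_sym AT !mulr0 !scale0r addr0 scaler0 mulr0 scaler0.
rewrite addr0 !eqxx (negPf full_neq0) eq_sym (negPf full_neq0) !mulr0 !scale0r.
rewrite add0r addr0 finset.cards0 expr0 mulr1 scale1r cl_sign0l scale1r.
rewrite monomial0 mul1r scalerDr finset.cardsT card_ord; congr (_ + _).
(* The full monomial carries s^n, which is s because n is odd. *)
rewrite mulr1 (expr_odd_involution s2) // -!scalerAr !scalerA.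
by congr (_ *: _); ring.
Qed.

(** If all averages were killed by [Z], then [sum_cl_average] for s = 1 and s = -1 would give two
    equations whose h^{1...n} terms cancel on addition, leaving 2 Z = 0. *)
Lemma cl_average_neq0 h Z : Z != 0 ->
  exists s : K, s * s = 1 /\
    exists F, Z * cl_average h (fun a => s *: cl_gen a) F != 0.
Proof.
move=> Z0; apply: contrapT => none.
have zero (s : K) : s * s = 1 ->
    Z * (1 + (sgn full full * s) *: (monomial h full * w)) = 0.
  move=> s2; apply: (@scalerI _ _ (2 ^+ (p + q) : K)); first exact: expf_neq0.
  rewrite scaler0 scalerAr -sum_cl_average // mulr_sumr big1 // => B _.
  rewrite -scalerAr mulrA; set V := Z * _.
  suff -> : V = 0 by rewrite mul0r scaler0.
  apply/eqP; apply: contrapT => /negP V0; apply: none.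
  by exists s; split => //; exists (cl_basis B).
have z1 := zero 1 (mulr1 1).
have := zero (-1); rewrite mulrNN mulr1 => /(_ erefl) zN1.
case/eqP: Z0; apply: (@scalerI _ _ (2 : K)) => //; rewrite scaler0.
have := congr2 +%R z1 zN1; rewrite addr0 -mulrDr mulr1 mulrN1 scaleNr.
by rewrite addrACA subrr addr0 -mulr2n -scaler_nat -scalerAr mulr1.
Qed.

(* Idempotent when [t * t = 1]; locked because rewriting with [scalerAr] would
   otherwise unfold it. *)
Definition idem (t : K) : Cl := locked (2^-1 *: (1 + t *: u)).

Lemma idemE t : idem t = 2^-1 *: (1 + t *: u).
Proof. by rewrite /idem -lock. Qed.

Lemma idem_central t X : idem t * X = X * idem t.
Proof.
by rewrite !idemE scalerDr !scalerA cl_central_scale.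
Qed.

Lemma vol_idem t : t * t = 1 -> u * idem t = t *: idem t.
Proof.
move=> t2; rewrite !idemE -scalerAr [RHS]scalerA (mulrC t) -[RHS]scalerA; congr (_ *: _).
by rewrite mulrDr mulr1 -scalerAr u_sq scalerDr scalerA t2 scale1r addrC.
Qed.

Lemma idemM t v : t * t = 1 -> idem v * idem t = (2^-1 * (1 + v * t)) *: idem t.
Proof.
move=> t2; rewrite {1}idemE -scalerAl mulrDl mul1r -scalerAl vol_idem //.
by rewrite scalerA -{1}(scale1r (idem t)) -scalerDl scalerA.
Qed.

Lemma idem_sum : idem 1 + idem (-1) = 1.
Proof.
rewrite !idemE -scalerDr scaleN1r scale1r addrACA subrr addr0.
by rewrite -mulr2n -scaler_nat scalerA mulVf // scale1r.
Qed.

Lemma idem_diff : idem 1 - idem (-1) = u.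
Proof.
rewrite !idemE -scalerBr scaleN1r scale1r opprD opprK addrACA subrr add0r.
by rewrite -mulr2n -scaler_nat scalerA mulVf // scale1r.
Qed.

Lemma idem_neq0 t : idem t != 0.
Proof.
apply/eqP => /ffunP/(_ finset.set0).
rewrite !idemE cl_volE !ffunE eqxx eq_sym (negPf full_neq0) /GRing.scale /= !mulr0 addr0.
by move/eqP; rewrite mulr1 invr_eq0 (negPf two_neq0).
Qed.

(* The annihilator of [T] is a two-sided ideal, and every nonzero ideal
   contains one of the two central idempotents. *)
Lemma annihilator_idem T X h : (forall a, h a * T = T * cl_gen a) ->
  X != 0 -> T * X = 0 -> exists t : K, t * t = 1 /\ T * idem t = 0.
Proof.
move=> hT X0 TX.
(* The right annihilator of [T] is also stable under left multiplication by e^A: T e^a Y = h^a T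
   Y. *)
have ann A Y : T * Y = 0 -> T * (cl_basis A * Y) = 0.
  move=> TY; rewrite -monomial_basis monomial_enum.
  elim: (enum A) => [|a r IH]; first by rewrite big_nil mul1r.
  by rewrite big_cons -mulrA mulrA -hT -mulrA IH mulr0.
have [A XA] : exists A, X A != 0.
  apply/existsP; apply: contraT; rewrite negb_exists => /forallP X_0.
  by case/eqP: X0; apply/ffunP => A; rewrite ffunE; apply/eqP; rewrite -[_ == _]negbK.
(* Multiplication by e^A moves a nonzero coefficient of [X] onto the identity, so that the central
   projection of [Y] does not vanish. *)
pose Y := cl_basis A * X.
have Y0 : Y finset.set0 != 0.
  have -> : finset.set0 = symdiff A A.
    by apply/setP=> x; rewrite in_symdiff addbb inE.
  rewrite cl_basisMl mulf_neq0 //; apply/eqP => s0.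
  by have := cl_sign_sq (K := K) A A; rewrite s0 mul0r => /eqP; rewrite eq_sym oner_eq0.
have TY : T * cl_average cl_gen cl_gen Y = 0.
  rewrite mulr_sumr big1 // => B _; rewrite monomial_basis -scalerAr.
  by rewrite mulrA ann ?mul0r ?scaler0 //; exact: ann.
move: TY; rewrite cl_averageE // -scalerAr => /eqP.
rewrite scaler_eq0 expf_eq0 (negPf two_neq0) andbF /= => /eqP.
set l : K := Y finset.set0; set m : K := Y full => TY.
have kappa0 : kappa != 0.
  apply/eqP => k0; move: u_sq; rewrite k0 scale0r mul0r => /eqP.
  by rewrite eq_sym oner_eq0.
(* On [idem t] the element [w] acts as t / kappa, hence l e + m w acts as the scalar l + t m /
   kappa. The two scalars for t = 1 and t = -1 add up to 2 l, so one of them is nonzero. *)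
have key t : t * t = 1 -> l + t * (m / kappa) != 0 ->
    exists t, t * t = 1 /\ T * idem t = 0.
  move=> t2 nz; exists t; split => //; apply: (scalerI nz).
  rewrite scaler0 -[RHS](mul0r (idem t)) -TY -mulrA scalerAr; congr (T * _).
  rewrite mulrDl -scalerAl mul1r -scalerAl.
  have -> : w * idem t = kappa^-1 *: (t *: idem t).
    by rewrite -vol_idem // -scalerAl scalerA mulVf // scale1r.
  by rewrite !scalerA -scalerDl; congr (_ *: _); ring.
have [z1|] := eqVneq (l + 1 * (m / kappa)) 0; last by apply: key; rewrite mulr1.
apply: (key (-1)); first by rewrite mulrNN mulr1.
have -> : l + -1 * (m / kappa) = 2 * l - (l + 1 * (m / kappa)) by ring.
by rewrite z1 subr0 mulf_neq0.
Qed.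

Theorem pauli_normal_form h : clifford_relations h ->
  exists s T, [/\ s \in [:: 1; -1; u; - u], T \is a GRing.unit,
    forall a, h a * T = T * (s * cl_gen a) & \prod_a h a = s * w].
Proof.
move=> hrel.
have one2 : 1 * 1 = 1 :> K by rewrite mulr1.
have oneN2 : -1 * -1 = 1 :> K by rewrite mulrNN mulr1.
have [s1 [s1_sq [F1 TF1]]] := cl_average_neq0 h (idem_neq0 1).
have [s2 [s2_sq [F2 TF2]]] := cl_average_neq0 h (idem_neq0 (-1)).
set T1 := idem 1 * _ in TF1; set T2 := idem (-1) * _ in TF2.
have id11 : idem 1 * idem 1 = idem 1.
  by rewrite idemM // mulr1 mulVf // scale1r.
have id22 : idem (-1) * idem (-1) = idem (-1).
  by rewrite idemM // oneN2 mulVf // scale1r.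
have id12 : idem 1 * idem (-1) = 0.
  by rewrite idemM // mul1r subrr mulr0 scale0r.
have id21 : idem (-1) * idem 1 = 0 by rewrite -idem_central.
have hT i F s a : s * s = 1 ->
    h a * (idem i * cl_average h (fun a => s *: cl_gen a) F) =
    idem i * cl_average h (fun a => s *: cl_gen a) F * (s *: cl_gen a).
  move=> s_sq; rewrite mulrA -idem_central -!mulrA cl_averageP //.
  exact: scale_gen_relations.
(* The signs [s1] and [s2] found on the two ideals may differ; [s] glues them into one central
   involution. *)
pose s : Cl := s1 *: idem 1 + s2 *: idem (-1).
have idT i F : idem i * F = F * idem i by exact: idem_central.
have T11 : T1 * idem 1 = T1 by rewrite -idT mulrA id11.
have T22 : T2 * idem (-1) = T2 by rewrite -idT mulrA id22.
have T12 : T1 * idem (-1) = 0 by rewrite -idT mulrA id21 mul0r.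
have T21 : T2 * idem 1 = 0 by rewrite -idT mulrA id12 mul0r.
pose T := T1 + T2.
have Ts : T * s = s1 *: T1 + s2 *: T2.
  by rewrite /T /s mulrDr -!scalerAr !mulrDl T11 T21 T12 T22 addr0 add0r.
have hTs a : h a * T = T * (s * cl_gen a).
  by rewrite mulrA Ts mulrDl -!scalerAl !scalerAr mulrDr !hT.
have s_sq : s * s = 1.
  rewrite /s mulrDl !mulrDr -!(scalerAl, scalerAr) id11 id12 id21 id22.
  by rewrite !scaler0 addr0 add0r !scalerA s1_sq s2_sq !scale1r idem_sum.
have s_central X : s * X = X * s.
  by rewrite /s mulrDl mulrDr -!scalerAl -!scalerAr !(idem_central _ X).
have sgn_cases (x : K) : x * x = 1 -> x = 1 \/ x = -1.
  move=> xx; have /eqP : (x - 1) * (x + 1) = 0.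
    by rewrite -subr_sqr expr1n expr2 xx subrr.
  by rewrite mulf_eq0 subr_eq0 addr_eq0 => /orP[] /eqP; [left|right].
(* A nonzero element killed by [T] would make [T] kill one of the idempotents, but the products of
   [T] with them are [T1] and [T2], both nonzero. *)
have Tunit : T \is a GRing.unit.
  apply: falg_unit_inj => X TX; apply/eqP; apply: contraT => X0.
  have hT' a : (s * h a) * T = T * cl_gen a.
    by rewrite -mulrA hTs mulrA s_central -mulrA (mulrA s s) s_sq mul1r.
  have [t [t2 Tt]] := annihilator_idem hT' X0 TX.
  case: (sgn_cases _ t2) => Et; move: Tt; rewrite Et mulrDl.
    by rewrite T11 T21 addr0 => /eqP; rewrite (negPf TF1).
  by rewrite T12 T22 add0r => /eqP; rewrite (negPf TF2).
exists s, T; split => //.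
  rewrite !inE /s.
  (* Equal signs give 1 or -1; opposite signs give [u] or [- u], the difference of the
     idempotents. *)
  case: (sgn_cases _ s1_sq) => ->; case: (sgn_cases _ s2_sq) => ->;
    rewrite ?scaleN1r ?scale1r ?idem_diff ?idem_sum ?eqxx ?orbT //.
  - have -> : - idem 1 + idem (-1) = - u by rewrite -idem_diff opprB addrC.
    by rewrite eqxx !orbT.
  - by rewrite -opprD idem_sum eqxx orbT.
(* Moving the whole product through [T] produces s^n [w], and s^n = s for odd n. *)
apply: (mulIr Tunit); rewrite (prod_intertwine _ hTs) prod_centralM //.
rewrite card_ord expr_odd_involution // -[\prod_(a <- _) _]/w.
by rewrite mulrA -s_central -!mulrA cl_vol_central.
Qed.
End PauliPointwise.

(** * Intertwiners between two Clifford families *)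

Section UnitRingLemmas.
Context {A : unitRingType}.
Implicit Types (s k y c T : A).

Lemma commute_intertwiners s k y T T' : (forall x, s * x = x * s) -> s * s = 1 ->
  T \is a GRing.unit -> y * T = T * (s * k) -> y * T' = T' * (s * k) ->
  k * (T^-1 * T') = T^-1 * T' * k.
Proof.
move=> sc s2 uT yT yT'; set Z := T^-1 * T'.
have TZ : T * Z = T' by rewrite mulVKr.
have skZ : s * k * Z = Z * (s * k).
  by apply: (mulrI uT); rewrite [LHS]mulrA -yT -[LHS]mulrA TZ yT' [RHS]mulrA TZ.
have kE : k = s * (s * k) by rewrite mulrA s2 mul1r.
by rewrite kE -[LHS]mulrA skZ [LHS]mulrA [RHS]mulrA (sc Z).
Qed.

Lemma conj_central c y T : (forall x, c * x = x * c) -> c \is a GRing.unit ->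
  T \is a GRing.unit -> (T * c)^-1 * y * (T * c) = T^-1 * y * T.
Proof.
move=> cc uc uT; rewrite invrM // -(cc T) -!mulrA (mulrA y) -(cc y) -mulrA.
by rewrite (mulrA T^-1) -(cc T^-1) -mulrA mulKr.
Qed.

End UnitRingLemmas.

Section Intertwiners.
Context {K : fieldType} {p q : nat}.
Hypothesis two_neq0 : 2 != 0 :> K.
Hypothesis odd_n : odd (p + q).
Local Notation I := 'I_(p + q).
Local Notation Cl := (clifford K p q).
Local Notation w := (@cl_vol K p q).
Implicit Types (X Y Z F T s : Cl) (h g : I -> Cl) (a b : I).

Variable kappa : K.
Local Notation u := (kappa *: w).
Hypothesis u_sq : u * u = 1.

Definition cl_signs : seq Cl := [:: 1; -1; u; - u].

Lemma cl_signs_sq s : s \in cl_signs -> s * s = 1.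
Proof.
by rewrite !inE => /or4P[] /eqP ->; rewrite ?mulrNN ?mulr1.
Qed.

Lemma cl_signs_central s X : s \in cl_signs -> s * X = X * s.
Proof.
have uX : u * X = X * u by rewrite -scalerAl -scalerAr cl_vol_central.
rewrite !inE => /or4P[] /eqP ->;
  by rewrite ?mulNr ?mulrN ?mul1r ?mulr1 ?uX.
Qed.

Lemma cl_signsM s t : s \in cl_signs -> t \in cl_signs -> s * t \in cl_signs.
Proof.
rewrite !inE => /or4P[] /eqP -> /or4P[] /eqP ->;
  by rewrite ?mulNr ?mulrN ?opprK ?mul1r ?mulr1 ?u_sq ?eqxx ?orbT.
Qed.

Lemma clifford_relations_central s h : s * s = 1 -> (forall X, s * X = X * s) ->
  clifford_relations h -> clifford_relations (fun a => s * h a).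
Proof.
move=> s2 sc hrel a b.
have E x y : s * x * (s * y) = x * y.
  by rewrite (sc x) -mulrA (mulrA s) s2 mul1r.
by rewrite !E hrel.
Qed.

Lemma vol_unit : w \is a GRing.unit.
Proof.
apply/unitrP; exists (kappa *: u).
have E : kappa *: (kappa *: (w * w)) = 1 by rewrite -u_sq -scalerAl -scalerAr.
by rewrite -!(scalerAl, scalerAr) E.
Qed.

Lemma clifford_prod_sign h : clifford_relations h ->
  exists2 s, s \in cl_signs & \prod_a h a = s * w.
Proof.
by move=> /(pauli_normal_form two_neq0 odd_n u_sq) [s [T [ss _ _ ->]]]; exists s.
Qed.

Lemma clifford_prod_central h X : clifford_relations h ->
  \prod_a h a * X = X * \prod_a h a.
Proof.
move=> /clifford_prod_sign [s ss ->].
by rewrite -mulrA cl_vol_central // !mulrA (cl_signs_central X ss).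
Qed.

Lemma clifford_prod_unit h : clifford_relations h -> \prod_a h a \is a GRing.unit.
Proof.
move=> /clifford_prod_sign [s ss ->]; rewrite unitrMl ?vol_unit //.
by apply/unitrP; exists s; rewrite cl_signs_sq.
Qed.

(** Composes the normal form of [h] with the inverse of that of [g]; the two central signs
    multiply. *)
Lemma clifford_intertwiner h g : clifford_relations h -> clifford_relations g ->
  exists s T, [/\ s \in cl_signs, T \is a GRing.unit,
    forall a, h a * T = T * (s * g a) & \prod_a h a = s * \prod_a g a].
Proof.
move=> /(pauli_normal_form two_neq0 odd_n u_sq) [s1 [T1 [ss1 uT1 hT1 Ph]]].
move=> /(pauli_normal_form two_neq0 odd_n u_sq) [s2 [T2 [ss2 uT2 hT2 Pg]]].
exists (s1 * s2), (T1 * T2^-1); split.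
- exact: cl_signsM.
- by rewrite unitrMl ?unitrV.
- move=> a.
  have E : s1 * s2 * g a * T2 = T2 * (s1 * cl_gen a).
    rewrite -mulrA hT2 mulrA (cl_signs_central _ (cl_signsM ss1 ss2)) -mulrA.
    by rewrite (mulrA (s1 * s2)) -(mulrA s1) cl_signs_sq // mulr1.
  by apply: (mulIr uT2); rewrite [in LHS]mulrA mulrVK // hT1 -[RHS]mulrA E -mulrA mulKr.
- by rewrite Ph Pg -mulrA (mulrA s2 s2) cl_signs_sq // mul1r.
Qed.

(** The normal form conjugates [h] to the generators up to a central sign, which does not affect
    commutation. *)
Lemma clifford_commutantP h Z : clifford_relations h ->
  (forall a, h a * Z = Z * h a) ->
  Z = (Z finset.set0 : K) *: 1 + (Z finset.setT : K) *: w.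
Proof.
move=> /(pauli_normal_form two_neq0 odd_n u_sq) [s [T [ss uT hT _]]] hZ.
pose Z' := T^-1 * Z * T.
have hE a : s * cl_gen a = T^-1 * h a * T by rewrite -mulrA hT mulKr.
have Z's a : s * cl_gen a * Z' = Z' * (s * cl_gen a).
  rewrite hE /Z' -!mulrA !(mulVKr uT); congr (_ * _).
  by rewrite !mulrA hZ.
have Z'com a : cl_gen a * Z' = Z' * cl_gen a.
  have genE : cl_gen a = s * (s * cl_gen a) by rewrite mulrA cl_signs_sq // mul1r.
  by rewrite genE -[LHS]mulrA Z's [LHS]mulrA [RHS]mulrA (cl_signs_central Z' ss).
(* The conjugate [Z'] is central, so conjugating it back changes nothing. *)
have : Z = Z'.
  apply: (mulIr uT); rewrite (cl_central Z'com) /Z'.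
  by rewrite !mulrA divrr // mul1r.
by move=> ->; apply: cl_commutantP => // a; rewrite Z'com.
Qed.

(** Multiplying the n relations gives g^{1...n} = s^n T^-1 h^{1...n} T; the conjugation disappears
    because h^{1...n} is central. *)
Lemma conj_relation_prod s T h g : (forall X, s * X = X * s) ->
  T \is a GRing.unit -> clifford_relations h -> clifford_relations g ->
  (forall a, g a = s * (T^-1 * h a * T)) -> \prod_a h a = s * \prod_a g a.
Proof.
move=> sc uT hrel grel ghT.
have hT a : h a * T = T * (T^-1 * h a * T) by rewrite -mulrA mulVKr.
(* Some of the six factors in [pauli_signs] square to -1. Squaring the relation at one index shows
   that such an [s] cannot satisfy the hypothesis. *)
have s2 : s * s = 1.
  pose a0 : I := Ordinal (odd_gt0 odd_n).
  have eta_unit : eta p q a0 a0 != 0 :> K.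
    by rewrite mxE eqxx; case: ifP => _; rewrite ?oppr_eq0 oner_eq0.
  apply: (scalerI eta_unit); rewrite -[RHS](clifford_sq two_neq0 a0 grel) ghT.
  set k := T^-1 * h a0 * T; have -> : s * k * (s * k) = s * s * (k * k).
    by rewrite -mulrA (mulrA k) -(sc k) !mulrA.
  have -> : k * k = T^-1 * (h a0 * h a0) * T by rewrite /k -!mulrA mulVKr.
  by rewrite (clifford_sq two_neq0 a0 hrel) -scalerAr mulr1 -scalerAl mulVr // -scalerAr mulr1.
have Pg : \prod_a g a = s * \prod_a h a.
  under eq_bigr => a _ do rewrite ghT.
  rewrite prod_centralM // card_ord expr_odd_involution //; congr (_ * _).
  apply: (mulrI uT); rewrite -(prod_intertwine _ hT).
  exact: clifford_prod_central.
by rewrite Pg mulrA s2 mul1r.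
Qed.

(** Each summand already equals [T]. Hence averaging an invertible intertwiner at a point keeps it
    invertible there in characteristic zero. *)
Lemma cl_average_intertwiner h g T : clifford_relations g ->
  (forall a, h a * T = T * g a) ->
  cl_average h g T = #|{set I}|%:R *: T.
Proof.
move=> grel hT; rewrite /cl_average (eq_bigr (fun=> T)) => [|A _].
  by rewrite sumr_const scaler_nat.
rewrite !monomial_enum (prod_intertwine _ hT) -!monomial_enum -mulrA monomialM //.
rewrite -scalerAr scalerA cl_sign_sq scale1r.
suff -> : symdiff A A = finset.set0 by rewrite monomial0 mulr1.
by apply/setP=> x; rewrite in_symdiff addbb inE.
Qed.

End Intertwiners.

(** * Continuous functions with finitely many values on a connected set *)

Lemma connected_finite_range (R : realType) (X : topologicalType) (D : set X)
    (f : X -> R) (s : seq R) :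
  connected D -> (forall x, D x -> {for x, continuous f}) ->
  (forall x, D x -> f x \in s) -> {in D &, forall x y, f x = f y}.
Proof.
move=> cD cf fs.
suff main x y : D x -> D y -> ~ f x < f y.
  move=> x y /set_mem Dx /set_mem Dy; apply/eqP; rewrite eq_le !leNgt.
  by apply/andP; split; apply/negP; apply: main.
move=> Dx Dy fxy.
have : connected (f @` D).
  apply: connected_continuous_connected => //.
  by apply: continuous_in_subspaceT => z /set_mem; exact: cf.
move/connected_intervalP => itv.
(* If f x < f y, the range contains the whole interval between them, hence these pairwise distinct
   values; the first [size s] + 1 of them already exceed the list. *)
pose v (n : nat) := f x + (f y - f x) / n.+1%:R.
have vs n : v n \in s.
  have : (f @` D) (v n).
    apply: (itv (f x) (f y)); [by exists x|by exists y|].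
    have d0 : 0 <= f y - f x by rewrite subr_ge0 ltW.
    rewrite /v lerDl divr_ge0 //= -[leRHS](subrKC (f x)) lerD2l.
    by rewrite ler_pdivrMr // ler_peMr // ler1n.
  by case=> z Dz <-; exact: fs.
have v_inj : injective v.
  move=> m n /addrI/mulfI; rewrite subr_eq0 gt_eqF // => /(_ isT)/invr_inj/eqP.
  by rewrite eqr_nat => /eqP[].
have /(uniq_leq_size _) : {subset map v (iota 0 (size s).+1) <= s}.
  by move=> _ /mapP[n _ ->].
by rewrite map_inj_uniq // iota_uniq size_map size_iota ltnn => /(_ isT).
Qed.

(** * Functions of class C^k *)

Section ClassC.
Context {R : realType} {r : nat}.
Implicit Types (U : set 'rV[R]_r) (f g : 'rV[R]_r -> R) (k : nat).

Lemma classC_continuous k U f : classC k U f ->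
  forall x, U x -> {for x, continuous f}.
Proof. by case: k => [|k] []. Qed.

Lemma classCW k U f : classC k.+1 U f -> classC k U f.
Proof.
elim: k f => [|k IH] f [cf df]; split => //.
by move=> i; have [dfi Cdfi] := df i; split => //; apply: IH.
Qed.

Lemma classC_subset k U U' f : U' `<=` U -> classC k U f -> classC k U' f.
Proof.
move=> U'U; elim: k f => [|k IH] f [cf df]; split => //.
- by move=> x /U'U; exact: cf.
- by move=> x /U'U; exact: cf.
move=> i; have [dfi Cdfi] := df i; split; last exact: IH.
by move=> x /U'U; exact: dfi.
Qed.

(** On an open set, continuity and derivatives depend only on germs. This lets the rules of calculus
    below be applied where they hold only on [U]. *)
Lemma classC_eq k U f g : open U -> (forall x, U x -> f x = g x) ->
  classC k U f -> classC k U g.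
Proof.
move=> oU.
have near_eq f1 g1 x : (forall x, U x -> f1 x = g1 x) -> U x ->
    {near x, f1 =1 g1}.
  move=> fg Ux; apply: filterS (open_nbhs_nbhs (conj oU Ux)) => y; exact: fg.
have continuous_eq f1 g1 x : (forall x, U x -> f1 x = g1 x) -> U x ->
    {for x, continuous f1} -> {for x, continuous g1}.
  move=> fg Ux cf; rewrite /prop_for /continuous_at -fg //.
  exact: cvg_trans (near_eq_cvg (near_eq _ _ _ fg Ux)) cf.
elim: k f g => [|k IH] f g fg [cf df]; split => //.
- by move=> x Ux; apply: continuous_eq fg Ux (cf x Ux).
- by move=> x Ux; apply: continuous_eq fg Ux (cf x Ux).
move=> i; have [dfi Cdfi] := df i; split.
  by move=> x Ux; apply: near_eq_derivable (near_eq _ _ _ fg Ux) (dfi x Ux).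
apply: IH Cdfi => x Ux; apply: near_eq_derive; exact: near_eq fg Ux.
Qed.

Lemma classC_cst k U (c : R) : classC k U (fun=> c).
Proof.
elim: k c => [|k IH] c; split => //.
- by move=> x _; exact: cst_continuous.
- by move=> x _; exact: cst_continuous.
move=> i; split; first by move=> x _; exact: derivable_cst.
have -> : (fun x => 'D_(delta_mx 0 i) (fun _ : 'rV[R]_r => c) x) = fun=> 0.
  by apply/funext => x; exact: derive_cst.
exact: IH.
Qed.

Lemma classC_add k U f g : open U -> classC k U f -> classC k U g ->
  classC k U (fun x => f x + g x).
Proof.
move=> oU; elim: k f g => [|k IH] f g [cf df] [cg dg]; split => //.
- by move=> x Ux; exact: (cvgD (cf x Ux) (cg x Ux)).
- by move=> x Ux; exact: (cvgD (cf x Ux) (cg x Ux)).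
move=> i; have [dfi Cdfi] := df i; have [dgi Cdgi] := dg i; split.
  by move=> x Ux; apply: derivableD; [exact: dfi|exact: dgi].
apply: classC_eq (IH _ _ Cdfi Cdgi) => // x Ux.
by rewrite deriveD //; [exact: dfi|exact: dgi].
Qed.

(** The Leibniz rule pairs a derivative with an undifferentiated factor, so the induction uses
    [classCW] to lower the order of that factor. *)
Lemma classC_mul k U f g : open U -> classC k U f -> classC k U g ->
  classC k U (fun x => f x * g x).
Proof.
move=> oU; elim: k f g => [|k IH] f g Cf Cg; have [cf df] := Cf;
  have [cg dg] := Cg; split => //.
- by move=> x Ux; exact: (cvgM (cf x Ux) (cg x Ux)).
- by move=> x Ux; exact: (cvgM (cf x Ux) (cg x Ux)).
move=> i; have [dfi Cdfi] := df i; have [dgi Cdgi] := dg i; split.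
  by move=> x Ux; apply: derivableM; [exact: dfi|exact: dgi].
apply: classC_eq (classC_add oU (IH _ _ (classCW Cf) Cdgi)
  (IH _ _ (classCW Cg) Cdfi)) => // x Ux.
by rewrite deriveM //; [exact: dfi|exact: dgi].
Qed.

Lemma classC_opp k U f : open U -> classC k U f -> classC k U (fun x => - f x).
Proof.
move=> oU Cf; have := classC_mul oU (classC_cst k U (-1)) Cf.
by apply: classC_eq => // x _; rewrite mulN1r.
Qed.

Lemma classC_inv k U f : open U -> (forall x, U x -> f x != 0) ->
  classC k U f -> classC k U (fun x => (f x)^-1).
Proof.
move=> oU f0; elim: k => [|k IH] Cf; have [cf df] := Cf; split => //.
- by move=> x Ux; exact: (cvgV (f0 x Ux) (cf x Ux)).
- by move=> x Ux; exact: (cvgV (f0 x Ux) (cf x Ux)).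
move=> i; have [dfi Cdfi] := df i; split.
  by move=> x Ux; apply: derivableV; [exact: f0|exact: dfi].
have Cinv := IH (classCW Cf).
apply: classC_eq (classC_opp oU (classC_mul oU (classC_mul oU Cinv Cinv) Cdfi)) => //.
move=> x Ux; rewrite deriveV; [|exact: f0|exact: dfi].
by rewrite /GRing.scale /= mulNr -expr2 exprVn.
Qed.

End ClassC.

Section ClassCComplex.
Context {R : realType} {r : nat}.
Implicit Types (U : set 'rV[R]_r) (f g : 'rV[R]_r -> R[i]) (k : nat).

Lemma classC_complex_subset k U U' f : U' `<=` U ->
  classC_complex k U f -> classC_complex k U' f.
Proof. by move=> U'U [? ?]; split; exact: classC_subset U'U _. Qed.

Lemma classC_complex_eq k U f g : open U -> (forall x, U x -> f x = g x) ->
  classC_complex k U f -> classC_complex k U g.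
Proof.
by move=> oU fg [fr fi]; split; [apply: classC_eq fr|apply: classC_eq fi] => // x Ux;
  rewrite fg.
Qed.

Lemma classC_complex_cst k U (c : R[i]) : classC_complex k U (fun=> c).
Proof. by split; exact: classC_cst. Qed.

Lemma classC_complex_add k U f g : open U -> classC_complex k U f ->
  classC_complex k U g -> classC_complex k U (fun x => f x + g x).
Proof.
move=> oU [fr fi] [gr gi]; split.
  apply: classC_eq (classC_add oU fr gr) => // x _.
  by case: (f x) (g x) => [? ?] [? ?].
apply: classC_eq (classC_add oU fi gi) => // x _.
by case: (f x) (g x) => [? ?] [? ?].
Qed.

Lemma classC_complex_mul k U f g : open U -> classC_complex k U f ->
  classC_complex k U g -> classC_complex k U (fun x => f x * g x).
Proof.
move=> oU [fr fi] [gr gi]; split.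
  apply: classC_eq (classC_add oU (classC_mul oU fr gr)
    (classC_opp oU (classC_mul oU fi gi))) => // x _.
  by case: (f x) (g x) => [? ?] [? ?].
apply: classC_eq (classC_add oU (classC_mul oU fr gi) (classC_mul oU fi gr)) => // x _.
by case: (f x) (g x) => [? ?] [? ?].
Qed.

Lemma classC_complex_inv k U f : open U -> (forall x, U x -> f x != 0) ->
  classC_complex k U f -> classC_complex k U (fun x => (f x)^-1).
Proof.
move=> oU f0 [fr fi].
(* The inverse of z is its conjugate divided by the squared modulus [n2]. *)
pose n2 x := complex.Re (f x) * complex.Re (f x) + complex.Im (f x) * complex.Im (f x).
have Cn : classC k U (fun x => (n2 x)^-1).
  apply: classC_inv => // [x /f0|].
    apply: contraNneq; rewrite /n2 -!expr2 => /eqP.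
    rewrite paddr_eq0 ?sqr_ge0 // !sqrf_eq0 => /andP[/eqP re0 /eqP im0].
    by rewrite eq_complex re0 im0 !eqxx.
  by apply: classC_add => //; exact: classC_mul.
split.
  apply: classC_eq (classC_mul oU fr Cn) => // x _.
  by rewrite /n2; case: (f x) => a b; rewrite -!expr2.
apply: classC_eq (classC_opp oU (classC_mul oU fi Cn)) => // x _.
by rewrite /n2; case: (f x) => a b; rewrite -!expr2.
Qed.

Lemma classC_complex_sum (I : Type) (s : seq I) (P : pred I) k U
    (F : I -> 'rV[R]_r -> R[i]) : open U ->
  (forall i, P i -> classC_complex k U (F i)) ->
  classC_complex k U (fun x => \sum_(i <- s | P i) F i x).
Proof.
move=> oU CF; elim: s => [|i s IH].
  by apply: classC_complex_eq (classC_complex_cst k U 0) => // x _; rewrite big_nil.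
have [Pi|nPi] := boolP (P i).
  apply: classC_complex_eq (classC_complex_add oU (CF i Pi) IH) => // x _.
  by rewrite big_cons Pi.
by apply: classC_complex_eq IH => // x _; rewrite big_cons (negPf nPi).
Qed.

Lemma classC_complex_prod (I : Type) (s : seq I) k U
    (F : I -> 'rV[R]_r -> R[i]) : open U ->
  (forall i, classC_complex k U (F i)) ->
  classC_complex k U (fun x => \prod_(i <- s) F i x).
Proof.
move=> oU CF; elim: s => [|i s IH].
  by apply: classC_complex_eq (classC_complex_cst k U 1) => // x _; rewrite big_nil.
apply: classC_complex_eq (classC_complex_mul oU (CF i) IH) => // x _.
by rewrite big_cons.
Qed.

Lemma classC_complex_det n k U (M : 'rV[R]_r -> 'M[R[i]]_n) : open U ->
  (forall i j, classC_complex k U (fun x => M x i j)) ->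
  classC_complex k U (fun x => \det (M x)).
Proof.
move=> oU CM; apply: classC_complex_sum => // s _.
apply: classC_complex_mul => //; first exact: classC_complex_cst.
exact: classC_complex_prod.
Qed.

Lemma classC_complex_continuous k U f x : classC_complex k U f -> U x ->
  {for x, continuous (fun y => complex.Re (f y))} /\
  {for x, continuous (fun y => complex.Im (f y))}.
Proof.
by move=> [fr fi] Ux; split;
  [exact: classC_continuous fr x Ux|exact: classC_continuous fi x Ux].
Qed.

Lemma classC_complex_near_neq0 k U f x : classC_complex k U f -> U x ->
  f x != 0 -> \forall y \near x, f y != 0.
Proof.
move=> Cf Ux; rewrite eq_complex negb_and => nz.
have [cr ci] := classC_complex_continuous Cf Ux.
case/orP: nz => nz.
  have : \forall y \near x, complex.Re (f y) != 0.
    exact: (cvgr_neq0 _ cr).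
  by apply: filterS => y; apply: contraNN => /eqP ->.
have : \forall y \near x, complex.Im (f y) != 0.
  exact: (cvgr_neq0 _ ci).
by apply: filterS => y; apply: contraNN => /eqP ->.
Qed.

End ClassCComplex.

(** * The right regular representation and inverses by Cramer's rule *)

Section RegularRepresentation.
Context {K : fieldType} {p q : nat}.
Local Notation Cl := (clifford K p q).
Local Notation N := #|{set 'I_(p + q)}|.
Implicit Types (X Y : Cl).

Definition cl_row X : 'rV[K]_N := \row_i X (enum_val i).

(** Matrix of right multiplication by [X] acting on row vectors, which makes it multiplicative
    without reversing the order. *)
Definition cl_mulmx X : 'M[K]_N :=
  \matrix_(i, j) (cl_basis (enum_val i) * X) (enum_val j).

Lemma cl_rowM X Y : cl_row (X * Y) = cl_row X *m cl_mulmx Y.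
Proof.
apply/rowP => j; rewrite !mxE [X in X * Y]cl_basis_sum mulr_suml sum_ffunE.
rewrite (reindex _ (onW_bij _ (@enum_val_bij {set 'I_(p + q)}))) /=.
by apply: eq_bigr => i _; rewrite -scalerAl !mxE ffunE.
Qed.

Lemma cl_row_inj : injective cl_row.
Proof.
move=> X Y /rowP XY; apply/ffunP => A.
by have := XY (enum_rank A); rewrite !mxE enum_rankK.
Qed.

Lemma cl_mulmx1 : cl_mulmx 1 = 1%:M.
Proof.
by apply/matrixP => i j; rewrite !mxE mulr1 ffunE (inj_eq enum_val_inj) eq_sym.
Qed.

Lemma cl_mulmxM X Y : cl_mulmx (X * Y) = cl_mulmx X *m cl_mulmx Y.
Proof.
apply/row_matrixP => i.
have rowE Z : row i (cl_mulmx Z) = cl_row (cl_basis (enum_val i) * Z).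
  by apply/rowP => j; rewrite !mxE.
by rewrite row_mul !rowE mulrA cl_rowM.
Qed.

Lemma cl_unitE X : (X \is a GRing.unit) = (\det (cl_mulmx X) != 0).
Proof.
rewrite -unitfE -unitmxE.
apply/idP/idP => [uX|uM].
  have : cl_mulmx X *m cl_mulmx X^-1 = 1%:M by rewrite -cl_mulmxM divrr // cl_mulmx1.
  by case/mulmx1_unit.
apply: falg_unit_inj => Y XY.
(* Solving Z X = 1 in coordinates gives a left inverse, which makes left multiplication by [X]
   injective. *)
pose Z : Cl := [ffun A => (cl_row 1 *m invmx (cl_mulmx X)) 0 (enum_rank A)].
have ZX : Z * X = 1.
  apply: cl_row_inj; rewrite cl_rowM -[RHS](mulmxKV uM); congr (_ *m _).
  by apply/rowP => i; rewrite mxE ffunE enum_valK.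
by rewrite -[Y]mul1r -ZX -mulrA XY mulr0.
Qed.

(** Cramer's rule: the coordinates of the inverse are rational functions of those of [X], so
    inversion preserves class C^k. *)
Lemma cl_rowV X : X \is a GRing.unit ->
  cl_row X^-1 = (\det (cl_mulmx X))^-1 *: (cl_row 1 *m \adj (cl_mulmx X)).
Proof.
move=> uX; have uM : cl_mulmx X \in unitmx by rewrite unitmxE unitfE -cl_unitE.
have -> : cl_row 1 = cl_row X^-1 *m cl_mulmx X by rewrite -cl_rowM mulVr.
rewrite -mulmxA mul_mx_adj mul_mx_scalar scalerA mulVf ?scale1r //.
by rewrite -cl_unitE.
Qed.

End RegularRepresentation.

(** * Clifford-valued functions of class C^k *)

Section ClassCClifford.
Context {R : realType} {p q r : nat}.
Local Notation Cl := (clifford R[i] p q).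
Implicit Types (U : set 'rV[R]_r) (F G : 'rV[R]_r -> Cl) (k : nat).

Lemma classC_clifford_subset k U U' F : U' `<=` U ->
  classC_clifford k U F -> classC_clifford k U' F.
Proof. by move=> U'U CF A; exact: classC_complex_subset U'U (CF A). Qed.

Lemma classC_clifford_eq k U F G : open U -> (forall x, U x -> F x = G x) ->
  classC_clifford k U F -> classC_clifford k U G.
Proof.
move=> oU FG CF A; apply: classC_complex_eq (CF A) => // x Ux.
by rewrite FG.
Qed.

Lemma classC_clifford_cst k U (X : Cl) : classC_clifford k U (fun=> X).
Proof. by move=> A; exact: classC_complex_cst. Qed.

Lemma classC_clifford_mul k U F G : open U -> classC_clifford k U F ->
  classC_clifford k U G -> classC_clifford k U (fun x => F x * G x).
Proof.
move=> oU CF CG A.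
apply: (@classC_complex_eq _ _ _ _ (fun x => \sum_B cl_sign B (symdiff B A) *
  (F x B * G x (symdiff B A)))) => // [x _|]; first by rewrite ffunE.
apply: classC_complex_sum => // B _; apply: classC_complex_mul => //.
  exact: classC_complex_cst.
exact: classC_complex_mul.
Qed.

Lemma classC_clifford_scale k U (l : 'rV[R]_r -> R[i]) F : open U ->
  classC_complex k U l -> classC_clifford k U F ->
  classC_clifford k U (fun x => l x *: F x).
Proof.
move=> oU Cl CF A; apply: classC_complex_eq (classC_complex_mul oU Cl (CF A)) => // x _.
by rewrite ffunE.
Qed.

Lemma classC_clifford_add k U F G : open U -> classC_clifford k U F ->
  classC_clifford k U G -> classC_clifford k U (fun x => F x + G x).
Proof.
move=> oU CF CG A; apply: classC_complex_eq (classC_complex_add oU (CF A) (CG A)) => // x _.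
by rewrite ffunE.
Qed.

Lemma classC_clifford_sum (I : Type) (s : seq I) k U
    (F : I -> 'rV[R]_r -> Cl) : open U ->
  (forall i, classC_clifford k U (F i)) ->
  classC_clifford k U (fun x => \sum_(i <- s) F i x).
Proof.
move=> oU CF; elim: s => [|i s IH].
  by apply: classC_clifford_eq (classC_clifford_cst k U 0) => // x _; rewrite big_nil.
apply: classC_clifford_eq (classC_clifford_add oU (CF i) IH) => // x _.
by rewrite big_cons.
Qed.

Lemma classC_clifford_prod (I : Type) (s : seq I) k U
    (F : I -> 'rV[R]_r -> Cl) : open U ->
  (forall i, classC_clifford k U (F i)) ->
  classC_clifford k U (fun x => \prod_(i <- s) F i x).
Proof.
move=> oU CF; elim: s => [|i s IH].
  by apply: classC_clifford_eq (classC_clifford_cst k U 1) => // x _; rewrite big_nil.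
apply: classC_clifford_eq (classC_clifford_mul oU (CF i) IH) => // x _.
by rewrite big_cons.
Qed.

Lemma classC_clifford_average k U (h g : 'I_(p + q) -> 'rV[R]_r -> Cl) (X : Cl) :
  open U -> (forall a, classC_clifford k U (h a)) ->
  (forall a, classC_clifford k U (g a)) ->
  classC_clifford k U (fun x => cl_average (h^~ x) (g^~ x) X).
Proof.
move=> oU Ch Cg; apply: classC_clifford_sum => // A.
have mono f : (forall a, classC_clifford k U (f a)) ->
    classC_clifford k U (fun x => monomial (f^~ x) A).
  move=> Cf; apply: classC_clifford_eq (classC_clifford_prod (enum A) oU Cf) => // x _.
  by rewrite monomial_enum.
apply: classC_clifford_scale => //; first exact: classC_complex_cst.
apply: classC_clifford_mul => //; last exact: mono.
by apply: classC_clifford_mul; [|exact: mono|exact: classC_clifford_cst].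
Qed.

Lemma classC_cl_mulmx k U F i j : open U -> classC_clifford k U F ->
  classC_complex k U (fun x => cl_mulmx (F x) i j).
Proof.
move=> oU CF; have := classC_clifford_mul oU
  (classC_clifford_cst k U (cl_basis (enum_val i))) CF.
by move/(_ (enum_val j)); apply: classC_complex_eq => // x _; rewrite mxE.
Qed.

Lemma classC_clifford_inv k U F : open U ->
  (forall x, U x -> F x \is a GRing.unit) ->
  classC_clifford k U F -> classC_clifford k U (fun x => (F x)^-1).
Proof.
move=> oU uF CF A.
have Cm i j := classC_cl_mulmx i j oU CF.
pose j := enum_rank A.
apply: (@classC_complex_eq _ _ _ _ (fun x => (\det (cl_mulmx (F x)))^-1 *
  \sum_i cl_row 1 0 i * cofactor (cl_mulmx (F x)) j i)) => // [x Ux|].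
  have := congr1 (fun M : 'rV_#|{set 'I_(p + q)}| => M 0 j) (cl_rowV (uF x Ux)).
  rewrite mxE enum_rankK => ->; rewrite mxE; congr (_ * _); rewrite mxE.
  by apply: eq_bigr => i _; rewrite [\adj _ _ _]mxE.
apply: classC_complex_mul => //.
  apply: classC_complex_inv => //; last exact: classC_complex_det.
  by move=> x Ux; rewrite -cl_unitE uF.
apply: classC_complex_sum => // i _; apply: classC_complex_mul => //.
  exact: classC_complex_cst.
apply: classC_complex_mul => //; first exact: classC_complex_cst.
apply: classC_complex_det => // a b.
by apply: classC_complex_eq (Cm (lift j a) (lift i b)) => // x _; rewrite !mxE.
Qed.

Lemma near_unit k U F x : open U -> classC_clifford k U F -> U x ->
  F x \is a GRing.unit -> \forall y \near x, F y \is a GRing.unit.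
Proof.
move=> oU CF Ux; rewrite cl_unitE => nz.
have Cdet : classC_complex k U (fun x => \det (cl_mulmx (F x))).
  by apply: classC_complex_det => // i j; exact: classC_cl_mulmx.
by apply: filterS (classC_complex_near_neq0 Cdet Ux nz) => y; rewrite cl_unitE.
Qed.

End ClassCClifford.

(** * Euclidean balls in the sup-norm topology *)

Section EuclideanBall.
Context {R : realType} {r : nat}.
Implicit Types (x : 'rV[R]_r) (eps : R).

Lemma enorm_continuous : continuous (@enorm R r).
Proof.
move=> x; apply: (continuous_comp (f := fun y : 'rV[R]_r => \sum_i y 0 i ^+ 2)).
  apply: continuous_big => [|i _ y]; first exact: add_continuous.
  rewrite /continuous_at expr2; under eq_fun do rewrite expr2.
  exact: (cvgM (@coord_continuous _ _ _ 0 i y) (@coord_continuous _ _ _ 0 i y)).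
exact: sqrt_continuous.
Qed.

Lemma eball_open x eps : open (eball x eps).
Proof.
rewrite (_ : eball x eps = (fun y => enorm (y - x)) @^-1` [set t | t < eps]) //.
apply: open_comp; last exact: open_lt.
move=> y _; apply: (@continuous_comp _ _ _ (fun z : 'rV[R]_r => z - x) (@enorm R r)).
  exact: (cvgB (@cvg_id _ (nbhs y)) (cvg_cst x)).
exact: enorm_continuous.
Qed.

Lemma eball_center x eps : 0 < eps -> eball x eps x.
Proof.
move=> e0; rewrite /eball /= subrr /enorm big1 ?sqrtr0 // => i _.
by rewrite mxE expr0n.
Qed.

(** Every coordinate is bounded by the Euclidean norm, so a Euclidean ball lies in the sup-norm ball
    of the same radius. *)
Lemma eball_sub_nbhs x (P : set 'rV[R]_r) : nbhs x P ->
  exists eps, 0 < eps /\ eball x eps `<=` P.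
Proof.
case/nbhs_ballP => e /= e0 eP; exists e; split => // y ye; apply: eP.
rewrite -ball_normE /= distrC [ltLHS]/Num.norm /= mx_normrE.
apply: bigmax_lt => // -[i j] _ /=; rewrite ord1 {i}; apply: le_lt_trans ye.
rewrite -sqrtr_sqr; apply: ler_wsqrtr.
by rewrite (bigD1 j) //= lerDl sumr_ge0 // => i _; exact: sqr_ge0.
Qed.

End EuclideanBall.

(** * The generalized Pauli theorem *)

Section PauliTransform.
Context {R : realType} {p q r : nat}.
Hypothesis odd_n : odd (p + q).
Local Notation C := R[i].
Local Notation I := 'I_(p + q).
Local Notation Cl := (clifford C p q).
Local Notation w := (cl_vol : Cl).
Implicit Types (k : nat) (U : set 'rV[R]_r) (H G s t : Cl).
Implicit Types (h g : I -> 'rV[R]_r -> Cl) (T : 'rV[R]_r -> Cl).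

Let two_neq0 : 2 != 0 :> C. Proof. by rewrite pnatr_eq0. Qed.

Definition pauli_signs : seq Cl :=
  [:: 1; -1; w; - w; 'i%C *: w; - ('i%C *: w)].

(** The square of [w] is 1 or -1; the factor 1 or i makes it 1, and the resulting four signs are
    among the six admissible ones. *)
Lemma vol_involution : exists kappa : C,
  (kappa *: w) * (kappa *: w) = 1 /\ {subset cl_signs kappa <= pauli_signs}.
Proof.
have ww : w * w = (@cl_sign C p q finset.setT finset.setT) *: 1.
  have vv : symdiff finset.setT finset.setT = finset.set0 :> {set I}.
    by apply/setP=> x; rewrite in_symdiff addbb inE.
  by rewrite cl_volE cl_basisM vv.
have /eqP := @cl_sign_sq C p q finset.setT finset.setT.
rewrite -expr2 -subr_eq0 -(expr1n _ 2) subr_sqr mulf_eq0 subr_eq0 addr_eq0.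
case/orP => /eqP E; rewrite E in ww; [exists 1|exists 'i%C]; split.
- by rewrite scale1r ww scale1r.
- by move=> s; rewrite !inE scale1r => /or4P[] ->; rewrite ?orbT.
- by rewrite -scalerAl -scalerAr scalerA ww scalerA -expr2 sqr_i mulrNN mulr1 scale1r.
- by move=> s; rewrite !inE => /or4P[] ->; rewrite ?orbT.
Qed.

Lemma pauli_signs_central s (X : Cl) : s \in pauli_signs -> s * X = X * s.
Proof.
have wX := @cl_vol_central C p q odd_n X.
rewrite !inE => /orP[/eqP ->|/orP[/eqP ->|/or4P[] /eqP ->]];
  by rewrite ?mulNr ?mulrN ?mul1r ?mulr1 -?scalerAl -?scalerAr ?wX.
Qed.

Lemma pauli_transformP k U h g H G T : pauli_transform k U h g H G T <->
  [/\ classC_clifford k U T, forall x, U x -> T x \is a GRing.unit &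
    forall s, s \in pauli_signs ->
      ((forall a x, U x -> g a x = s * ((T x)^-1 * h a x * T x)) <-> H = s * G)].
Proof.
have cond (s B : Cl) (A : I -> 'rV[R]_r -> Cl) :
    (forall a x, A a x = s * ((T x)^-1 * h a x * T x)) -> B = s * G ->
    ((forall a x, U x -> g a x = A a x) <-> H = B) <->
    ((forall a x, U x -> g a x = s * ((T x)^-1 * h a x * T x)) <-> H = s * G).
  move=> EA ->; have -> : A = fun a x => s * ((T x)^-1 * h a x * T x).
    by apply/funext => a; apply/funext => x.
  by [].
split=> [[CT [uT [c1 [c2 [c3 [c4 [c5 c6]]]]]]]|[CT uT c]].
  split => // s.
  rewrite !inE => /orP[/eqP ->|/orP[/eqP ->|/or4P[] /eqP ->]].
  - by apply: (proj1 (cond _ _ _ _ _) c1) => *; rewrite ?mul1r.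
  - by apply: (proj1 (cond _ _ _ _ _) c2) => *; rewrite ?mulN1r.
  - by apply: (proj1 (cond _ _ _ _ _) c3) => *; rewrite ?mulrA.
  - by apply: (proj1 (cond _ _ _ _ _) c4) => *; rewrite ?mulNr ?mulrA.
  - by apply: (proj1 (cond _ _ _ _ _) c5) => *; rewrite ?mulrA.
  - by apply: (proj1 (cond _ _ _ _ _) c6) => *; rewrite ?mulNr ?mulrA.
do 2!split => //.
split; first by apply: (proj2 (cond 1 _ _ _ _) (c 1 _)) => *;
  rewrite ?(inE, eqxx, orbT, mul1r).
split; first by apply: (proj2 (cond (-1) _ _ _ _) (c (-1) _)) => *;
  rewrite ?(inE, eqxx, orbT, mulN1r).
split; first by apply: (proj2 (cond w _ _ _ _) (c w _)) => *;
  rewrite ?(inE, eqxx, orbT, mulrA).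
split; first by apply: (proj2 (cond (- w) _ _ _ _) (c (- w) _)) => *;
  rewrite ?(inE, eqxx, orbT, mulNr, mulrA).
split; first by apply: (proj2 (cond ('i%C *: w) _ _ _ _) (c ('i%C *: w) _)) => *;
  rewrite ?(inE, eqxx, orbT, mulrA).
by apply: (proj2 (cond (- ('i%C *: w)) _ _ _ _) (c (- ('i%C *: w)) _)) => *;
  rewrite ?(inE, eqxx, orbT, mulNr, mulrA).
Qed.

(** Since [G] is invertible, H = t G forces t = s, so all six equivalences reduce to the single
    relation with factor [s]. The point [x0] serves to compare the products. *)
Lemma pauli_transform_sign k U h g H G T s x0 : U x0 ->
  (forall x, U x -> clifford_relations (h^~ x)) ->
  (forall x, U x -> clifford_relations (g^~ x)) ->
  (forall x, U x -> \prod_a h a x = H) -> (forall x, U x -> \prod_a g a x = G) ->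
  s \in pauli_signs -> H = s * G ->
  pauli_transform k U h g H G T <->
  [/\ classC_clifford k U T, forall x, U x -> T x \is a GRing.unit &
    forall a x, U x -> g a x = s * ((T x)^-1 * h a x * T x)].
Proof.
move=> Ux0 hrel grel hH gG ss HG; have [kappa [u_sq _]] := vol_involution.
split=> [/pauli_transformP[CT uT c]|[CT uT gT]].
  by split => //; apply/(c s ss).
apply/pauli_transformP; split => // t ts; split=> [gt|Ht].
  rewrite -(hH x0 Ux0) -(gG x0 Ux0).
  apply: (conj_relation_prod two_neq0 odd_n u_sq _ (uT x0 Ux0)
    (hrel x0 Ux0) (grel x0 Ux0)) => [X|a]; first exact: pauli_signs_central.
  exact: gt.
have uG : G \is a GRing.unit.
  by rewrite -(gG x0 Ux0); exact: (clifford_prod_unit two_neq0 odd_n u_sq (grel x0 Ux0)).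
by have <- : s = t by apply: (mulIr uG); rewrite -HG.
Qed.

Lemma clifford_prod_constant k U h : connected U ->
  (forall a, classC_clifford k U (h a)) ->
  open U -> (forall x, U x -> clifford_relations (h^~ x)) ->
  exists H, forall x, U x -> \prod_a h a x = H.
Proof.
move=> cU Ch oU hrel; have [kappa [u_sq _]] := vol_involution.
have [[x0 Ux0]|U0] := pselect (U !=set0); last first.
  by exists 0 => x Ux; case: U0; exists x.
exists (\prod_a h a x0) => x Ux; apply/ffunP => A.
have Cprod : classC_clifford k U (fun y => \prod_a h a y).
  exact: (classC_clifford_prod (index_enum _) oU Ch).
have [cre cim] := Cprod A.
have values y : U y -> exists2 s, s \in cl_signs kappa & \prod_a h a y = s * w.
  by move=> /hrel; exact: (clifford_prod_sign two_neq0 odd_n u_sq).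
have constant (f : C -> R) :
    (forall y, U y -> {for y, continuous (fun y => f ((\prod_a h a y) A))}) ->
    f ((\prod_a h a x) A) = f ((\prod_a h a x0) A).
  move=> cf.
  (* The product is always some s [w] with [s] among four signs, so each real or imaginary part of a
     coordinate is continuous with finitely many values. *)
  apply: (connected_finite_range (s := [seq f ((s * w) A) | s <- cl_signs kappa])
    cU cf) => [y Uy||]; [|exact/mem_set|exact/mem_set].
  by have [s ss ->] := values y Uy; apply/mapP; exists s.
apply/eqP; rewrite eq_complex; apply/andP; split; apply/eqP.
  by apply: (constant (@complex.Re R)); exact: classC_continuous cre.
by apply: (constant (@complex.Im R)); exact: classC_continuous cim.
Qed.

Lemma pauli_transform_exists k U h g x0 : open U -> U x0 ->
  (forall a, classC_clifford k U (h a)) -> (forall a, classC_clifford k U (g a)) ->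
  (forall x, U x -> clifford_relations (h^~ x)) ->
  (forall x, U x -> clifford_relations (g^~ x)) ->
  exists s eps T,
    [/\ s * s = 1, s \in pauli_signs, \prod_a h a x0 = s * \prod_a g a x0,
      0 < eps & eball x0 eps `<=` U] /\
    [/\ classC_clifford k (eball x0 eps) T,
      forall x, eball x0 eps x -> T x \is a GRing.unit &
      forall a x, eball x0 eps x -> g a x = s * ((T x)^-1 * h a x * T x)].
Proof.
move=> oU Ux0 Ch Cg hrel grel; have [kappa [u_sq sub]] := vol_involution.
have [s [T0 [ss uT0 hT0 HG]]] :=
  clifford_intertwiner two_neq0 odd_n u_sq (hrel x0 Ux0) (grel x0 Ux0).
have s_sq := cl_signs_sq u_sq ss.
have s_central X : s * X = X * s := pauli_signs_central X (sub s ss).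
have sgrel x : U x -> clifford_relations (fun a => s * g a x).
  by move=> Ux; exact: (clifford_relations_central s_sq s_central (grel x Ux)).
(* The sign is absorbed into the second family and the seed [T0] is frozen, so [T] depends on x only
   through monomials in [h] and [g]. *)
pose T x := cl_average (h^~ x) (fun a => s * g a x) T0.
have CT : classC_clifford k U T.
  apply: (classC_clifford_average (g := fun a x => s * g a x)) => // a.
  by apply: classC_clifford_mul => //; exact: classC_clifford_cst.
have uTx0 : T x0 \is a GRing.unit.
  rewrite /T (cl_average_intertwiner two_neq0 (sgrel x0 Ux0) hT0).
  by rewrite scaler_unit // unitfE pnatr_eq0 -lt0n; apply/card_gt0P; exists finset.set0.
have : nbhs x0 (U `&` [set x | T x \is a GRing.unit]).
  by apply: filterI; [exact: open_nbhs_nbhs|exact: near_unit oU CT Ux0 uTx0].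
case/eball_sub_nbhs => eps [e0 sube]; exists s, eps, T; split; split.
- exact: s_sq.
- exact: sub.
- exact: HG.
- exact: e0.
- by move=> x /sube[].
- by apply: classC_clifford_subset CT => x /sube[].
- by move=> x /sube[].
move=> a x /sube[Ux uT]; rewrite -mulrA.
rewrite /T (cl_averageP two_neq0 _ _ (hrel x Ux) (sgrel x Ux)) -/(T x).
by rewrite mulKr // mulrA s_sq mul1r.
Qed.

Lemma pauli_transform_unique k U h g T T' s : open U ->
  (forall x, U x -> clifford_relations (g^~ x)) ->
  s * s = 1 -> s \in pauli_signs ->
  classC_clifford k U T -> (forall x, U x -> T x \is a GRing.unit) ->
  (forall a x, U x -> g a x = s * ((T x)^-1 * h a x * T x)) ->
  [/\ classC_clifford k U T', forall x, U x -> T' x \is a GRing.unit &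
    forall a x, U x -> g a x = s * ((T' x)^-1 * h a x * T' x)] <->
  exists lambda nu : 'rV[R]_r -> C,
    classC_complex k U lambda /\ classC_complex k U nu /\
    (forall x, U x -> (lambda x *: 1 + nu x *: w : Cl) \is a GRing.unit) /\
    (forall x, U x -> T' x = T x * (lambda x *: 1 + nu x *: w)).
Proof.
move=> oU grel s_sq ss CT uT gT; have [kappa [u_sq _]] := vol_involution.
have sc X : s * X = X * s := pauli_signs_central X ss.
have hE T1 a x : U x -> T1 x \is a GRing.unit ->
    g a x = s * ((T1 x)^-1 * h a x * T1 x) -> h a x * T1 x = T1 x * (s * g a x).
  by move=> Ux uT1 ->; rewrite mulrA s_sq mul1r -mulrA mulVKr.
split=> [[CT' uT' gT']|[lambda [nu [Clam [Cnu [ulam T'E]]]]]].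
  (* The quotient commutes with every g^a, hence is central; its coordinates on the identity and on
     the volume element are the functions [lambda] and [nu]. *)
  pose Z x := (T x)^-1 * T' x.
  have CZ : classC_clifford k U Z.
    exact: (classC_clifford_mul oU (classC_clifford_inv oU uT CT) CT').
  have uZ x : U x -> Z x \is a GRing.unit.
    by move=> Ux; rewrite unitrMl ?uT' // unitrV uT.
  have ZE x : U x -> Z x = (Z x finset.set0 : C) *: 1 + (Z x finset.setT : C) *: w.
    move=> Ux; apply: (clifford_commutantP two_neq0 odd_n u_sq (grel x Ux)) => a.
    exact: (commute_intertwiners sc s_sq (uT x Ux)
      (hE _ _ _ Ux (uT x Ux) (gT a x Ux)) (hE _ _ _ Ux (uT' x Ux) (gT' a x Ux))).
  exists (fun x => Z x finset.set0), (fun x => Z x finset.setT).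
  split; first exact: CZ.
  split; first exact: CZ.
  split=> x Ux; rewrite -ZE //; first exact: uZ.
  by rewrite /Z mulVKr // uT.
pose c x : Cl := lambda x *: 1 + nu x *: w.
have cc x X : c x * X = X * c x by exact: cl_central_scale.
split=> [|x Ux|a x Ux].
- have Cc : classC_clifford k U c.
    by apply: classC_clifford_add => //; apply: classC_clifford_scale => //;
      exact: classC_clifford_cst.
  by apply: classC_clifford_eq (classC_clifford_mul oU CT Cc) => // x /T'E.
- by rewrite T'E // unitrMl ?uT // ulam.
(* A central invertible factor cancels in the conjugation. *)
rewrite (T'E x Ux) (conj_central _ (cc x) (ulam x Ux) (uT x Ux)).
exact: gT.
Qed.

End PauliTransform.

Theorem theorem3 (R : realType) (p q r k : nat) (Omega : set 'rV[R]_r)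
    (h g : 'I_(p + q) -> 'rV[R]_r -> clifford R[i] p q) :
  odd (p + q) ->
  open Omega -> connected Omega -> Omega !=set0 ->
  (forall a, classC_clifford k Omega (h a)) ->
  (forall a, classC_clifford k Omega (g a)) ->
  (forall x, Omega x -> clifford_relations (fun a => h a x)) ->
  (forall x, Omega x -> clifford_relations (fun a => g a x)) ->
  exists H G : clifford R[i] p q,
    (forall x, Omega x -> \prod_(a < p + q) h a x = H) /\
    (forall x, Omega x -> \prod_(a < p + q) g a x = G) /\
    forall x0, Omega x0 ->
    exists eps : R, 0 < eps /\ eball x0 eps `<=` Omega /\
    exists T : 'rV[R]_r -> clifford R[i] p q,
      pauli_transform k (eball x0 eps) h g H G T /\
      forall T' : 'rV[R]_r -> clifford R[i] p q,
        pauli_transform k (eball x0 eps) h g H G T' <->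
        exists lambda nu : 'rV[R]_r -> R[i],
          classC_complex k (eball x0 eps) lambda /\
          classC_complex k (eball x0 eps) nu /\
          (forall x, eball x0 eps x ->
             (lambda x *: 1 + nu x *: cl_vol : clifford R[i] p q)
               \is a GRing.unit) /\
          (forall x, eball x0 eps x ->
             T' x = T x * (lambda x *: 1 + nu x *: cl_vol)).
Proof.
move=> odd_n oO cO _ Ch Cg hrel grel.
have [H hH] := clifford_prod_constant odd_n cO Ch oO hrel.
have [G gG] := clifford_prod_constant odd_n cO Cg oO grel.
exists H, G; split; first exact: hH.
split; first exact: gG.
move=> x0 Ox0.
have [s [eps [T [[s_sq ss HG e0 sub] [CT uT gT]]]]] :=
  pauli_transform_exists odd_n oO Ox0 Ch Cg hrel grel.
rewrite hH // gG // in HG.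
have ptE := pauli_transform_sign odd_n k _ (eball_center x0 e0)
  (fun x Ux => hrel x (sub x Ux)) (fun x Ux => grel x (sub x Ux))
  (fun x Ux => hH x (sub x Ux)) (fun x Ux => gG x (sub x Ux)) ss HG.
exists eps; split; first exact: e0.
split; first exact: sub.
exists T; split; first exact/ptE.
move=> T'; apply: (iff_trans (ptE T')).
exact: (pauli_transform_unique odd_n T' (@eball_open _ _ x0 eps)
  (fun x Ux => grel x (sub x Ux)) s_sq ss CT uT gT).
Qed.
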